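(* Fix $n\ge 2$, distinct indices $i\neq j$ in $\{1,\dots,n\}$, a tolerance $c>0$ and a deviation level $\delta^i>0$; put $\bar\delta=\delta^i+c$ and $U_{\delta^i}=(-\infty,-\bar\delta)\cup(\bar\delta,\infty)$. Let $\Sigma_0$ be the nominal steady-state covariance described in the context, let $\varepsilon^-\in[0,1)$, $\varepsilon^+\ge 0$, and let $$\mathcal M=\{\mathbb P=\mathcal N(0,\Sigma)\text{ on }\mathbb R^n:\ (1-\varepsilon^-)\Sigma_0\preceq\Sigma\preceq(1+\varepsilon^+)\Sigma_0\}.$$ For $\mathbb P=\mathcal N(0,\Sigma)\in\mathcal M$ and $y=(y_1,\dots,y_n)\sim\mathbb P$, let $\sigma_i^2=\Sigma_{ii}$, $\sigma_j^2=\Sigma_{jj}$, $\rho=\Sigma_{ij}/(\sigma_i\sigma_j)$, $\rho'=\sqrt{1-\rho^2}$, $\delta^*=\bar\delta/(\sqrt2\,\sigma_i)$, and $$\mathbb E^j_i(\mathbb P)=\frac{\mathbb E_{\mathbb P}\big[|y_j|\,\mathbf 1_{\{y_i\in U_{\delta^i}\}}\big]}{\mathbb P(y_i\in U_{\delta^i})}.$$ Then for every $\mathbb P\in\mathcal M$, $$\mathbb E^j_i(\mathbb P)=\sqrt{\frac{2}{\pi}}\,\frac{\sigma_j}{1-\operatorname{erf}(\delta^* )}\left[1-\operatorname{erf}\!\left(\frac{\delta^*}{\rho'}\right)+\rho\,\operatorname{erf}\!\left(\frac{\rho\,\delta^*}{\rho'}\right)e^{-(\delta^* )^2}\right],$$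 and the distributionally robust cascading risk $\mathcal R^j_i:=\inf\{\delta\ge 0:\ \sup_{\mathbb P\in\mathcal M}\mathbb E^j_i(\mathbb P)\le \delta+c\}$ equals $0$ if $\sup_{\mathbb P\in\mathcal M}\mathbb E^j_i(\mathbb P)\le c$, and equals $\sup_{\mathbb P\in\mathcal M}\mathbb E^j_i(\mathbb P)-c$ otherwise.
   Context: Setting: $n$ agents with states $x_t\in\mathbb R^n$ evolving by $\mathrm d x_t=-L\,x_{t-\tau}\,\mathrm dt+b\,\mathrm d w_t$, where $w_t$ is an $n$-dimensional standard Brownian motion, $b\neq 0$, $\tau\ge0$, and $L$ is the Laplacian of a connected, undirected, simple graph with positive edge weights $k_{ij}$ ($L_{ij}=-k_{ij}$ for $i\ne j$, $L_{ii}=\sum_j k_{ij}$). Write $L=Q\Lambda Q^\top$ with $Q=[q_1|\dots|q_n]$ orthogonal, $q_1=\mathbf 1_n/\sqrt n$, $\Lambda=\mathrm{diag}(0,\lambda_2,\dots,\lambda_n)$, $0<\lambda_2\le\dots\le\lambda_n$, and assume the stability condition $\tau<\pi/(2\lambda_n)$. The observables are $y_t=M_nx_t$ with $M_n=I_n-\frac1n\mathbf 1_n\mathbf 1_n^\top$; their steady-state distribution is $\mathcal N(0,\Sigma)$ with $\Sigma=b^2M_nQ\Psi Q^\top M_n$, $\Psi=\mathrm{diag}\big(0,\psi(\lambda_2),\dots,\psi(\lambda_n)\big)$, $\psi(\lambda)=\frac{\cos(\lambda\tau)}{2\lambda(1-\sin(\lambda\tau))}$. The nominal covariance $\Sigma_0$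 is this matrix evaluated at nominal parameter values $(b_0,\tau_0,L_0)$ satisfying the same assumptions. $\operatorname{erf}(x)=\frac{2}{\sqrt\pi}\int_0^xe^{-t^2}dt$.
   Formalization: For n=2 one always has ρ=−1 and ρ'=0, so δ*/ρ' and ρδ*/ρ' in the formula are undefined; there the two erf terms are read as their limits erf(±∞)=±1 (the sign of the numerator). For n≥3, ρ'>0 and the formula is unchanged. *)

(* Defs.v *)
From HB Require Import structures.
From mathcomp Require Import all_boot all_order all_algebra.
From mathcomp Require Import all_classical all_reals all_analysis.
Set Implicit Arguments. Unset Strict Implicit. Unset Printing Implicit Defensive.
Import Order.TTheory GRing.Theory Num.Theory.
Import numFieldNormedType.Exports.
Local Open Scope classical_set_scope.
Local Open Scope ring_scope.

Section Defs.
Variable R : realType.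

Definition erf (x : R) : R :=
  2 / Num.sqrt pi *
  (if 0 <= x then Rintegral lebesgue_measure `[0, x] (fun t => expR (- t ^+ 2))
   else - Rintegral lebesgue_measure `[x, 0] (fun t => expR (- t ^+ 2))).

(* erf (a / b), read with the continuous extension erf(+-oo) = +-1 when b = 0 *)
Definition erf_ratio (a b : R) : R :=
  if b == 0 then Num.sg a else erf (a / b).

Variable n : nat.

Definition laplacian (k : 'M[R]_n) : 'M[R]_n :=
  \matrix_(a, b) (if a == b then \sum_(c < n) k a c else - k a b).

Definition connected_weighted_graph (k : 'M[R]_n) : Prop :=
  [/\ forall a, k a a = 0,
      forall a b, k a b = k b a,
      forall a b, 0 <= k a b &
      forall a b, connect [rel x y | 0 < k x y] a b].

Definition centering : 'M[R]_n := 1%:M - (n%:R)^-1 *: const_mx 1.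

Definition psi (tau lam : R) : R :=
  cos (lam * tau) / (2 * lam * (1 - sin (lam * tau))).

Definition steady_cov (b tau : R) (Q : 'M[R]_n) (lam : 'I_n -> R) : 'M[R]_n :=
  b ^+ 2 *: (centering *m Q *m
     diag_mx (\row_a (if val a == 0%N then 0 else psi tau (lam a)))
     *m Q^T *m centering).

Definition nominal_params (b tau : R) (k : 'M[R]_n) (Q : 'M[R]_n)
    (lam : 'I_n -> R) : Prop :=
  b != 0 /\ 0 <= tau /\ connected_weighted_graph k /\
  Q *m Q^T = 1%:M /\
  laplacian k = Q *m diag_mx (\row_a lam a) *m Q^T /\
  (forall a c : 'I_n, val c = 0%N -> Q a c = (Num.sqrt n%:R)^-1) /\
  (forall a : 'I_n, val a = 0%N -> lam a = 0) /\
  (forall a : 'I_n, (0 < val a)%N -> 0 < lam a) /\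
  (forall a c : 'I_n, (val a <= val c)%N -> lam a <= lam c) /\
  (forall a : 'I_n, val a = n.-1 -> tau < pi / (2 * lam a)).

Definition quad (S : 'M[R]_n) (u : 'I_n -> R) : R :=
  \sum_(a < n) \sum_(c < n) u a * S a c * u c.

Definition loewner_le (A B : 'M[R]_n) : Prop := forall u, quad A u <= quad B u.

(* P = N(0, S) on R^n (possibly degenerate): every linear form u.y is
   distributed as N(0, u^T S u) (a Dirac mass at 0 when u^T S u = 0) *)
Definition is_centered_gaussian (P : probability (n.-tuple R) R) (S : 'M[R]_n)
  : Prop :=
  S^T = S /\
  forall (u : 'I_n -> R) (A : set R), measurable A ->
    P [set y | A (\sum_(a < n) u a * tnth y a)] =
    (if quad S u == 0 then \d_(0 : R) A
     else normal_prob 0 (Num.sqrt (quad S u)) A).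

Definition ambiguity_set (S0 : 'M[R]_n) (em ep : R)
  : set (probability (n.-tuple R) R) :=
  [set P | exists S, [/\ is_centered_gaussian P S,
     loewner_le ((1 - em) *: S0) S & loewner_le S ((1 + ep) *: S0)]].

Definition Uset (dbar : R) : set R := `]-oo, - dbar[ `|` `]dbar, +oo[.

Definition cond_abs_mean (P : probability (n.-tuple R) R) (i j : 'I_n) (dbar : R)
  : R :=
  fine (\int[P]_(y in [set y | Uset dbar (tnth y i)]) (`|tnth y j|)%:E)%E
  / fine (P [set y | Uset dbar (tnth y i)]).

End Defs.

(* Main.v *)
Require Import Defs.
From HB Require Import structures.
From mathcomp Require Import all_boot all_order all_algebra.
From mathcomp Require Import all_classical all_reals all_analysis.
From mathcomp Require Import measurable_realfun ring lra.
Set Implicit Arguments. Unset Strict Implicit. Unset Printing Implicit Defensive.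
Import Order.TTheory GRing.Theory Num.Theory.
Import numFieldNormedType.Exports.
Local Open Scope classical_set_scope.
Local Open Scope ring_scope.

(* The law of y is only given through its linear forms, so the joint law of
   (y_i, y_j) has to be recovered first.  With X = y_i / sigma_i and
   Z = (y_j / sigma_j - rho X) / rho', every a X + b Z has law
   N(0, a^2 + b^2).  Hence E[cos(a X + b Z)] = exp(-(a^2 + b^2) / 2), which
   factors, and X, Z are independent standard normal variables by uniqueness
   of characteristic functions.  Fubini then gives
   E[|rho X + rho' Z|; |X| > d] as an integral over |x| > d whose integrand has
   an explicit antiderivative in terms of erf.  When rho' = 0, y_j is almost
   surely a multiple of y_i.  The variances are positive because
   Sigma_0 has positive diagonal: a zero entry would force the i-th row of
   M_n Q, hence of M_n, to vanish. *)

(** * Standard normal density and error function *)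

(** A matrix [S] representing [P] is only given as symmetric, and it is not given as the matrix that
    membership in the ambiguity set provides. Positivity therefore comes from evaluating laws on
    test events: half-lines show that the quadratic form is nonnegative, and the point 0 separates
    zero variance from positive variance. Independence takes two passes of a one-variable uniqueness
    theorem: trigonometric functions of X are replaced by indicators while those of Z act as
    weights, then the roles are exchanged. The weights that arise change sign, which is why
    uniqueness is not phrased for probability laws. Indicators are reached through explicit
    polynomials in sines and cosines that converge pointwise and boundedly. Cosines and sines are
    shifted by 1 whenever a law is transported, so that the integrands are nonnegative. *)

Definition phi (R : realType) (x : R) : R :=
  (Num.sqrt (2 * pi))^-1 * expR (- (x ^+ 2 / 2)).

Section gaussian.
Context (R : realType).
Local Notation mu := (@lebesgue_measure R).
Local Notation phi := (@phi R).
Local Notation gamma := (normal_prob (0 : R) 1).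

Lemma phiE : phi = normal_pdf 0 1.
Proof.
apply/funext => x; rewrite /phi normal_pdfE ?oner_eq0// /normal_peak /normal_fun.
by rewrite expr1n mul1r subr0 mulNr mulr_natl.
Qed.

Lemma phi_ge0 x : 0 <= phi x. Proof. by rewrite phiE normal_pdf_ge0. Qed.

Lemma continuous_phi : continuous phi.
Proof. by rewrite phiE; apply: continuous_normal_pdf; exact: oner_neq0. Qed.

Lemma measurable_phi : measurable_fun setT phi.
Proof. by rewrite phiE; exact: measurable_normal_pdf. Qed.

Lemma phiN x : phi (- x) = phi x. Proof. by rewrite /phi sqrrN. Qed.

(** The change of variables is phrased with a Radon-Nikodym derivative. It agrees almost everywhere
    with [phi] because both have the same integral over every measurable set. *)
Lemma integral_std_normal (f : R -> \bar R) (D : set R) :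
  (forall x, (0 <= f x)%E) -> measurable D -> measurable_fun D f ->
  (\int[gamma]_(x in D) f x = \int[mu]_(x in D) (f x * (phi x)%:E))%E.
Proof.
move=> f0 mD mf; have dom := normal_prob_dominates (0 : R) 1.
rewrite -(Radon_Nikodym_SigmaFinite.change_of_variables dom f0 mD mf).
apply: ae_eq_integral => //.
- apply: emeasurable_funM => //; apply: (measurable_int mu).
  apply: (integrableS _ _ (@subsetT _ _)) => //.
  exact: Radon_Nikodym_SigmaFinite.f_integrable.
- apply: emeasurable_funM => //; apply/measurableT_comp => //.
  by apply/measurable_funTS; exact: measurable_phi.
- apply: ae_eqe_mul2l; apply: integral_ae_eq => //.
  + apply: (integrableS _ _ (@subsetT _ _)) => //.
    exact: Radon_Nikodym_SigmaFinite.f_integrable.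
  + by apply/measurable_funTS/measurableT_comp => //; exact: measurable_phi.
  + move=> E E01 mE.
    by rewrite -Radon_Nikodym_SigmaFinite.f_integral// phiE.
Qed.

End gaussian.

Section erf_theory.
Context (R : realType).
Local Notation mu := (@lebesgue_measure R).
Implicit Types x : R.

(** A single antiderivative on the whole line: it absorbs the sign distinction in [erf] and gives
    differentiability at 0 as well. *)
Let F x := Rintegral mu `]-oo, x] (@gauss_fun R).

Let igauss (D : set R) : measurable D -> mu.-integrable D (EFin \o @gauss_fun R).
Proof.
by move=> mD; apply: (integrableS _ _ (@subsetT _ _)) => //; exact: integrableT_gauss.
Qed.

Let erfF x : erf x = 2 / Num.sqrt pi * (F x - F 0).
Proof.
rewrite /erf; congr (_ * _); case: ifPn => [x0|].
  rewrite /F Rintegral_itvB//; last exact: igauss.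
  by rewrite Rintegral_itv_obnd_cbnd//; exact: igauss.
rewrite -ltNge => x0; rewrite -[RHS]opprB; congr (- _).
rewrite /F Rintegral_itvB//; [|exact: igauss|by rewrite bnd_simp ltW].
by rewrite Rintegral_itv_obnd_cbnd//; exact: igauss.
Qed.

Lemma is_derive_erf x :
  is_derive x (1 : R) (@erf R) (2 / Num.sqrt pi * expR (- x ^+ 2)).
Proof.
have -> : @erf R = (2 / Num.sqrt pi) *: (F - cst (F 0)).
  by apply/funext => y; rewrite erfF.
have [dF F'] : derivable F x 1 /\ (F^`())%classic x = gauss_fun x.
  apply: (@continuous_FTC1 _ _ _ _ (x + 1)); first by rewrite ltrDl.
  - exact: igauss.
  - by rewrite ltNyr.
  - exact: continuous_gauss_fun.
have dF' : is_derive x (1 : R) F (gauss_fun x).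
  by apply: DeriveDef => //; rewrite -derive1E.
rewrite -[expR _]subr0 -[_ * _]/(_ *: _).
by apply: is_deriveZ; apply: is_deriveB.
Qed.

Lemma erf0 : erf (0 : R) = 0.
Proof. by rewrite erfF subrr mulr0. Qed.

Lemma continuous_erf : continuous (@erf R).
Proof.
move=> x; apply: differentiable_continuous; apply/derivable1_diffP.
by have [] := is_derive_erf x.
Qed.

Lemma erfN x : erf (- x) = - erf x.
Proof.
apply/eqP; rewrite -subr_eq0 opprK; apply/eqP.
have -> : 0 = erf (- 0) + erf 0 :> R by rewrite oppr0 erf0 addr0.
apply: (@is_derive_0_is_cst _ (fun y => erf (- y) + erf y)) => y.
have H1 : is_derive y (1 : R) (fun y => erf (- y))
    (- (2 / Num.sqrt pi * expR (- y ^+ 2))).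
  have := @is_derive1_comp _ (@erf R) -%R y _ _ (is_derive_erf (- y)) _.
  by move=> /(_ (-1)); rewrite sqrrN mulrN1; apply; exact: is_deriveN.
rewrite -(addNr (2 / Num.sqrt pi * expR (- y ^+ 2))).
exact: (is_deriveD H1 (is_derive_erf y)).
Qed.

(** The Gaussian integral enters through the limit [pi / 4] of the squared integral over [[0, x]];
    nonnegativity allows the square root to be taken. *)
Lemma cvg_erfy : erf x @[x --> +oo] --> (1 : R).
Proof.
have sqrt_pi : Num.sqrt pi != 0 :> R by rewrite gt_eqF// sqrtr_gt0 pi_gt0.
have cvgI : Num.sqrt (gauss_integral_proof.integral0_gauss x ^+ 2) @[x --> +oo]
    --> Num.sqrt (pi / 4 : R).
  apply: continuous_cvg; first exact: sqrt_continuous.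
  exact: gauss_integral_proof.cvg_integral0_gauss_sqr.
have limE : 1 = 2 / Num.sqrt pi * Num.sqrt (pi / 4) :> R.
  rewrite (_ : pi / 4 = pi * 2^-1 ^+ 2 :> R); last by field.
  by rewrite sqrtrM ?pi_ge0// sqrtr_sqr ger0_norm//; field.
rewrite limE; have := cvgMl_tmp (a := 2 / Num.sqrt pi) cvgI.
move=> /(_ _); apply: cvg_trans; apply: near_eq_cvg; near=> x.
rewrite /= sqrtr_sqr ger0_norm ?gauss_integral_proof.integral0_gauss_ge0//.
by rewrite /erf ifT//; near: x; exact: nbhs_pinfty_ge.
Unshelve. all: end_near. Qed.

End erf_theory.

(** * Characteristic function of the standard normal law *)

Section pointwise_derivatives.
Context (R : realType).
Implicit Types (f g : R -> R) (x c df dg : R).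

Lemma is_derive_mulrl c x : is_derive x (1 : R) ( *%R c) c.
Proof.
have := is_deriveZ c (is_derive_id x (1 : R)).
by rewrite -[c *: 1]/(c * 1) mulr1.
Qed.

Lemma is_derive_mul f g x df dg :
  is_derive x (1 : R) f df -> is_derive x (1 : R) g dg ->
  is_derive x (1 : R) (fun y => f y * g y) (df * g x + f x * dg).
Proof.
by move=> hf hg; apply: (is_derive_eq (is_deriveM hf hg)); rewrite addrC mulrC.
Qed.

Lemma is_derive_scale f c x df :
  is_derive x (1 : R) f df -> is_derive x (1 : R) (fun y => c * f y) (c * df).
Proof. exact: is_deriveZ. Qed.

Lemma is_derive_comp_mul f c x df :
  is_derive (c * x) (1 : R) f df ->
  is_derive x (1 : R) (fun y => f (c * y)) (df * c).
Proof. by move=> hf; exact: (is_derive1_comp hf (is_derive_mulrl c x)). Qed.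

Lemma is_derive_add f g x df dg :
  is_derive x (1 : R) f df -> is_derive x (1 : R) g dg ->
  is_derive x (1 : R) (fun y => f y + g y) (df + dg).
Proof. exact: is_deriveD. Qed.

Lemma is_derive_expR_sqr c x :
  is_derive x (1 : R) (fun y => expR (c * y ^+ 2)) (2 * c * x * expR (c * x ^+ 2)).
Proof.
have H : is_derive x (1 : R) (fun y => c * y ^+ 2) (c * (2 * x)).
  apply: is_derive_scale; apply: (is_derive_eq (is_deriveX 2 (is_derive_id x _))).
  by rewrite -[_ *: _]/(_ * _) mulr1 expr1.
apply: (is_derive_eq (is_derive1_comp (is_derive_expR _) H)).
by rewrite /=; ring.
Qed.

End pointwise_derivatives.

(** * Fundamental theorem of calculus on a half-line for signed integrands *)

Section ftc_integrable.
Context (R : realType).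
Local Notation mu := (@lebesgue_measure R).

Lemma integrable_FTC2y (f F : R -> R) (a l : R) :
  continuous f -> mu.-integrable `[a, +oo[ (EFin \o f) ->
  (forall x : R, is_derive x (1 : R) F (f x)) -> F x @[x --> +oo] --> l ->
  Rintegral mu `[a, +oo[ f = l - F a.
Proof.
move=> cf intf dF Fl.
have mf : measurable_fun setT f by exact: continuous_measurable_fun.
have cF : continuous F.
  move=> x; apply: differentiable_continuous; apply/derivable1_diffP.
  by have [] := dF x.
(* The successor keeps the interval nondegenerate at [n = 0], as [continuous_FTC2] requires. *)
pose D n := `[a, a + n.+1%:R]%classic : set R.
have FTC n : (\int[mu]_(x in D n) (f x)%:E = (F (a + n.+1%:R) - F a)%:E)%E.
  rewrite (@continuous_FTC2 _ f F)//.
  - by rewrite ltrDl.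
  - exact: continuous_subspaceT.
  - split => [x _||]; first by have [] := dF x.
      exact/cvg_at_right_filter/cF.
    exact/cvg_at_left_filter/cF.
  - by move=> x _; rewrite derive1E; have [_ ->] := dF x.
pose g n := EFin \o (f \_ (D n)).
have mg n : measurable_fun `[a, +oo[ (g n).
  apply: measurable_funTS; apply/measurable_EFinP.
  by apply: (measurable_restrictT f (measurable_itv _)).1; exact: measurable_funTS.
have gf x : `[a, +oo[%classic x -> g ^~ x @ \oo --> (EFin \o f) x.
  rewrite /= in_itv/= andbT => ax.
  apply: cvg_near_cst; near=> n.
  rewrite /g/= patchE ifT// inE /D/= in_itv/= ax/= -lerBlDl.
  near: n; exists (Num.bound (x - a)) => // m /= mx.
  rewrite (le_trans (ltW (archi_boundP _)))// ?subr_ge0//.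
  by rewrite ler_nat ltnW.
have gb x n : `[a, +oo[%classic x -> (`|g n x| <= (abse \o (EFin \o f)) x)%E.
  move=> _; rewrite /g /= patchE lee_fin; case: ifPn => // _.
  by rewrite normr0.
have mf' : measurable_fun `[a, +oo[ (EFin \o f).
  exact/measurable_EFinP/measurable_funTS.
have [||_ _] := @dominated_convergence _ (measurableTypeR R) R mu _ (measurable_itv _)
  g _ _ mg mf' _ (integrable_abse intf).
- exact: aeW.
- exact: aeW.
rewrite /= (_ : (fun n => _) = (fun n => (F (a + n.+1%:R) - F a)%:E)); last first.
  apply/funext => n; rewrite -FTC /g -restrict_EFin -integral_mkcondr.
  congr integral; rewrite setIidr//.
  by move=> x; rewrite /D /= !in_itv/= andbT => /andP[].
have ifin : (\int[mu]_(x in `[a, +oo[) (EFin \o f) x)%E \is a fin_num.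
  exact: integrable_fin_num.
rewrite -(fineK ifin) => /fine_cvg H.
apply: (cvg_unique _ H) => //; apply: cvgB; last exact: cvg_cst.
apply: (cvg_comp _ F _ Fl); apply/cvgryPge => A.
near=> n; rewrite -lerBlDl.
apply: (@le_trans _ _ n%:R); last by rewrite ler_nat.
near: n; exact: nbhs_infty_ger.
Unshelve. all: end_near. Qed.

End ftc_integrable.

Section gaussian_characteristic_function.
Context (R : realType).
Local Notation mu := (@lebesgue_measure R).
Local Notation phi := (@phi R).

#[local] Instance is_derive_phi (x : R) : is_derive x (1 : R) phi (- (x * phi x)).
Proof.
have -> : phi = fun y => (Num.sqrt (2 * pi))^-1 * expR (- 2^-1 * y ^+ 2).
  by apply/funext => y; congr (_ * expR _); field.
apply: (is_derive_eq (is_derive_scale _ (is_derive_expR_sqr _ _))).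

by field; rewrite gt_eqF// sqrtr_gt0 mulr_gt0 ?pi_gt0.
Qed.

Lemma cvg_phiy : phi x @[x --> +oo] --> (0 : R).
Proof.
rewrite -(mulr0 (Num.sqrt (2 * pi))^-1); apply: cvgMl_tmp.
apply: (cvg_comp (fun x : R => x ^+ 2 / 2) (fun x => expR (- x))).
  by apply: gt0_cvgMly => //; exact: cvgr_expr2.
exact: cvgr_expR.
Qed.

Lemma cvg_bounded_mul_phiy (g : R -> R) (M : R) :
  (forall x, `|g x| <= M) -> g x * phi x @[x --> +oo] --> (0 : R).
Proof.
move=> gM; apply: norm_cvg0.
apply: (@squeeze_cvgr _ _ _ _ (cst 0) (fun x => M * phi x)).
- by near=> x; rewrite normr_ge0 normrM (ger0_norm (phi_ge0 _)) ler_wpM2r ?phi_ge0.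
- exact: cvg_cst.
- by rewrite -(mulr0 M); apply: cvgMl_tmp; exact: cvg_phiy.
Unshelve. all: end_near. Qed.

Lemma integrable_phi (D : set R) : measurable D -> mu.-integrable D (EFin \o phi).
Proof.
move=> mD; apply: (integrableS _ _ (@subsetT _ _)) => //.
by rewrite phiE; exact: integrable_normal_pdf.
Qed.

(** Supplies the dominating function for differentiating a cosine transform under the integral;
    [- phi] is an antiderivative. *)
Lemma integrable_id_phi :
  mu.-integrable `[0, +oo[ (EFin \o (fun x => x * phi x)).
Proof.
have mf : measurable_fun setT (fun x : R => x * phi x).
  by apply: measurable_funM => //; exact: measurable_phi.
apply/integrableP; split; first exact/measurable_EFinP/measurable_funTS.
under eq_integral.
  move=> x; rewrite inE/= in_itv/= andbT => x0.
  rewrite ger0_norm ?mulr_ge0 ?phi_ge0//.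
  over.
rewrite (@ge0_continuous_FTC2y _ _ (fun x => - phi x) 0 0) ?ltry//.
- by move=> x x0; rewrite mulr_ge0 ?phi_ge0.
- apply: continuous_subspaceT => x; apply: cvgM => //; exact: continuous_phi.
- by rewrite -oppr0; apply: cvgN; exact: cvg_phiy.
- by apply: cvg_at_right_filter; exact: (cvgN (@continuous_phi R 0)).
- move=> x _; rewrite derive1E.
  by have [_ ->] := is_deriveN (is_derive_phi x); rewrite opprK.
Qed.

Lemma sqrt2_gt0 : 0 < Num.sqrt 2 :> R. Proof. by rewrite sqrtr_gt0. Qed.

Lemma sqrtpi_gt0 : 0 < Num.sqrt pi :> R. Proof. by rewrite sqrtr_gt0 pi_gt0. Qed.

Lemma phi_sqrt x : phi x = expR (- (x ^+ 2 / 2)) / (Num.sqrt 2 * Num.sqrt pi).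
Proof. by rewrite /phi sqrtrM// mulrC. Qed.

Lemma cvg_erf_muly (c : R) : 0 < c -> erf (c * x) @[x --> +oo] --> (1 : R).
Proof.
move=> c0; apply: (cvg_comp _ (@erf R) _ (@cvg_erfy R)).
by apply: gt0_cvgMry => //; exact: cvg_id.
Qed.

(** This antiderivative is the standard normal distribution function minus one half. *)
Lemma is_derive_half_erf (x : R) :
  is_derive x (1 : R) (fun y : R => 2^-1 * erf ((Num.sqrt 2)^-1 * y)) (phi x).
Proof.
apply: (is_derive_eq (is_derive_scale _ (is_derive_comp_mul (is_derive_erf _)))).
rewrite phi_sqrt exprMn exprVn sqr_sqrtr// [_^-1 * x ^+ 2]mulrC.
by field; rewrite !gt_eqF// ?sqrt2_gt0 ?sqrtpi_gt0.
Qed.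

Lemma Rintegral_phiy (a : R) :
  Rintegral mu `[a, +oo[ phi = 2^-1 * (1 - erf ((Num.sqrt 2)^-1 * a)).
Proof.
rewrite (@integrable_FTC2y _ _ _ _ 2^-1 (@continuous_phi R) _ is_derive_half_erf).
- by rewrite mulrBr mulr1.
- exact: integrable_phi.
- rewrite -[X in _ --> X]mulr1; apply: cvgMl_tmp; apply: cvg_erf_muly.
  by rewrite invr_gt0 sqrt2_gt0.
Qed.

(* [K] solves [K' = - r K]: differentiate under the integral, then integrate
   [x * phi x] by parts. *)
Let K r := Rintegral mu `[0, +oo[ (fun x => cos (r * x) * phi x).

Let integrable_trig_phi (t h : R -> R) r : (forall x, `|t x| <= 1) ->
  measurable_fun setT t -> measurable_fun setT h ->
  mu.-integrable `[0, +oo[ (EFin \o h) ->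
  mu.-integrable `[0, +oo[ (EFin \o (fun x => t (r * x) * h x)).
Proof.
move=> t1 mt mh; apply: le_integrable => //.
  apply/measurable_EFinP/measurable_funTS; apply: measurable_funM => //.
  apply: (measurableT_comp mt); exact: measurable_funM.
move=> x _; rewrite lee_fin normrM -[leRHS]mul1r.
by rewrite ler_wpM2r// (le_trans (t1 _)).
Qed.

Let msin : measurable_fun setT (@sin R).
Proof. by apply: continuous_measurable_fun; exact: continuous_sin. Qed.

Let mcos : measurable_fun setT (@cos R).
Proof. by apply: continuous_measurable_fun; exact: continuous_cos. Qed.

Let icos r : mu.-integrable `[0, +oo[ (EFin \o (fun x => cos (r * x) * phi x)).
Proof.
apply: integrable_trig_phi => //; [exact: cos_max|exact: measurable_phi|].
exact: integrable_phi.
Qed.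

Let isin r :
  mu.-integrable `[0, +oo[ (EFin \o (fun x => sin (r * x) * (x * phi x))).
Proof.
apply: integrable_trig_phi => //; [exact: sin_max| |exact: integrable_id_phi].
by apply: measurable_funM => //; exact: measurable_phi.
Qed.

Let is_derive_cos_mul (x r : R) :
  is_derive r (1 : R) (fun s => cos (s * x) * phi x) (- (sin (r * x) * (x * phi x))).
Proof.
have -> : (fun s => cos (s * x) * phi x) = (fun s => phi x * cos (x * s)).
  by apply/funext => s; rewrite mulrC (mulrC s).
apply: (is_derive_eq (is_derive_scale _ (is_derive_comp_mul (is_derive_cos _)))).
by rewrite (mulrC r); ring.
Qed.

Let K_parts r :
  Rintegral mu `[0, +oo[ (fun x => sin (r * x) * (x * phi x)) = r * K r.
Proof.
(* The derivative of [sin (r * x) * phi x], which vanishes at 0 and at infinity, so [f] integrates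
   to 0. *)
pose f x := r * (cos (r * x) * phi x) - sin (r * x) * (x * phi x).
have icos' : mu.-integrable `[0, +oo[ (EFin \o (fun x => r * (cos (r * x) * phi x))).
  exact: (@integrableZl _ (measurableTypeR R) R mu _ (measurable_itv _) r _ (icos r)).
have dF x : is_derive x (1 : R) (fun y => sin (r * y) * phi y) (f x).
  apply: (is_derive_eq (is_derive_mul (is_derive_comp_mul (is_derive_sin _))
    (is_derive_phi x))).
  by rewrite /f; ring.
have cf : continuous f.
  move=> x; apply: cvgB; apply: cvgM.
  - exact: cvg_cst.
  - apply: cvgM; last exact: continuous_phi.
    apply: (continuous_comp (f := *%R r)); last exact: continuous_cos.
    exact: mulrl_continuous.
  - apply: (continuous_comp (f := *%R r)); last exact: continuous_sin.
    exact: mulrl_continuous.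
  - by apply: cvgM => //; exact: continuous_phi.
have := @integrable_FTC2y _ f _ 0 0 cf _ dF.
rewrite mulr0 sin0 mul0r subr0 RintegralB// => FTC.
have : Rintegral mu `[0, +oo[ (fun x => r * (cos (r * x) * phi x)) -
  Rintegral mu `[0, +oo[ (fun x => sin (r * x) * (x * phi x)) = 0.
  apply: FTC.
    exact: (@integrableB _ (measurableTypeR R) R mu _ (measurable_itv _) _ _ icos' (isin r)).
  by apply: (@cvg_bounded_mul_phiy _ 1) => x; exact: sin_max.
by rewrite RintegralZl// => /subr0_eq.
Qed.

Let is_derive_K (r : R) : is_derive r (1 : R) K (- (r * K r)).
Proof.
pose f s x := cos (s * x) * phi x.
have d1fE s x : partial1of2 f s x = - (sin (s * x) * (x * phi x)).
  by rewrite partial1of2E; have [_ <-] := is_derive_cos_mul x s.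
have Ir : `]r - 1, r + 1[%classic r by rewrite /= in_itv/= ltrBlDr !ltrDl ltr01.
have G_ub s x : `]r - 1, r + 1[%classic s -> `[0, +oo[%classic x ->
    `|partial1of2 f s x| <= `|x * phi x|.
  move=> _ _; rewrite d1fE normrN normrM -[leRHS]mul1r.
  by rewrite ler_wpM2r// sin_max.
have df s x : `]r - 1, r + 1[%classic s -> `[0, +oo[%classic x ->
    derivable (f ^~ x) s 1.
  by move=> _ _; have [] := is_derive_cos_mul x s.
have iG : mu.-integrable `[0, +oo[ (EFin \o (fun x => `|x * phi x|)).
  exact: (integrable_abse integrable_id_phi).
have mI : measurable (`[0, +oo[%classic : set (measurableTypeR R)) by [].
apply: DeriveDef.
  by apply: (@derivable_under_integral _ _ _ mu f _ mI _ _ _ Ir (fun s _ => icos s) df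
    (fun x => `|x * phi x|)).
rewrite -derive1E (@differentiation_under_integral _ _ _ mu f _ mI _ _ _ Ir (fun s _ => icos s) df
    (fun x => `|x * phi x|))//.
rewrite -K_parts -[RHS]mulN1r -RintegralZl//; apply: eq_Rintegral => x _.
by rewrite d1fE mulN1r.
Qed.

Lemma half_gaussian_cos (r : R) :
  Rintegral mu `[0, +oo[ (fun x => cos (r * x) * phi x) = 2^-1 * expR (- (r ^+ 2 / 2)).
Proof.
(* Integrating factor: by [K' = - r K] this product has zero derivative. *)
have H : K r * expR (2^-1 * r ^+ 2) = K 0 * expR (2^-1 * 0 ^+ 2).
  apply: (@is_derive_0_is_cst _ (fun r => K r * expR (2^-1 * r ^+ 2))) => s.
  apply: (is_derive_eq (is_derive_mul (is_derive_K s) (is_derive_expR_sqr _ _))).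
  by field.
have K0 : K 0 = 2^-1.
  rewrite /K; under eq_Rintegral do rewrite mul0r cos0 mul1r.
  by rewrite Rintegral_phiy mulr0 erf0 subr0 mulr1.
have H0 : K 0 * expR (2^-1 * 0 ^+ 2) = 2^-1 by rewrite K0 expr0n/= mulr0 expR0 mulr1.
have expR_neq0 : expR (2^-1 * r ^+ 2) != 0 by rewrite gt_eqF// expR_gt0.
apply: (mulIf expR_neq0).
by rewrite -/(K r) H H0 -mulrA -expRD addrC [_ / 2]mulrC subrr expR0 mulr1.
Qed.

(** The added 1 makes the integrand nonnegative, as [integral_std_normal] requires; evenness then
    reduces to the half-line. *)
Lemma integral_gaussian_cos (r : R) :
  (\int[normal_prob (0 : R) 1]_x (1 + cos (r * x))%:E = (1 + expR (- (r ^+ 2 / 2)))%:E)%E.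
Proof.
have ge0 x : 0 <= 1 + cos (r * x) by rewrite -lerBlDl sub0r cos_geN1.
have mf : measurable_fun setT (fun x => 1 + cos (r * x)).
  by apply: measurable_funD => //; apply: measurableT_comp => //; exact: measurable_funM.
rewrite integral_std_normal//; last exact/measurable_EFinP.
under eq_integral do rewrite -EFinM.
rewrite ge0_symfun_integralT.
- rewrite -set_itvcy.
  have -> : (fun x => ((1 + cos (r * x)) * phi x)%:E) =
      (EFin \o (fun x => phi x + cos (r * x) * phi x)).
    by apply/funext => x; rewrite /= mulrDl mul1r.
  have iD : mu.-integrable `[0, +oo[ (EFin \o (fun x => phi x + cos (r * x) * phi x)).
    exact: (@integrableD _ (measurableTypeR R) R mu _ (measurable_itv _) _ _
      (integrable_phi (measurable_itv _)) (icos r)).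
  have ifin := @integrable_fin_num _ (measurableTypeR R) R mu _ (measurable_itv _) _ iD.
  rewrite -(fineK ifin) -[fine _]/(Rintegral _ _ _) RintegralD//; last exact: integrable_phi.
  rewrite Rintegral_phiy half_gaussian_cos mulr0 erf0 -EFinM; congr (_%:E).
  by field.
- by move=> x; rewrite mulr_ge0 ?phi_ge0.
- move=> x; apply: cvgM; last exact: continuous_phi.
  apply: cvgD; first exact: cvg_cst.
  apply: (continuous_comp (f := *%R r)); last exact: continuous_cos.
  exact: mulrl_continuous.
- by move=> x; rewrite /= phiN mulrN cosN.
Qed.

End gaussian_characteristic_function.

(** * Uniqueness of characteristic functions *)

Definition bounded_measurable d (T : measurableType d) (R : realType) (W : T -> R) :=
  measurable_fun setT W /\ exists M : R, forall t, `|W t| <= M.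

Section bounded_measurable.
Context d (T : measurableType d) (R : realType).
Local Notation bm := (@bounded_measurable d T R).
Implicit Types U V W : T -> R.

Lemma bm_cst (k : R) : bm (cst k).
Proof. by split; [exact: measurable_cst|exists `|k|]. Qed.

Lemma bmD U V : bm U -> bm V -> bm (fun t => U t + V t).
Proof.
move=> [mU [M UM]] [mV [N VN]]; split; first exact: measurable_funD.
by exists (M + N) => t; rewrite (le_trans (ler_normD _ _))// lerD.
Qed.

Lemma bmM U V : bm U -> bm V -> bm (fun t => U t * V t).
Proof.
move=> [mU [M UM]] [mV [N VN]]; split; first exact: measurable_funM.
by exists (M * N) => t; rewrite normrM ler_pM.
Qed.

Lemma bm_cos (X : T -> R) (a : R) : measurable_fun setT X ->
  bm (fun t => cos (a * X t)).
Proof.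
move=> mX; split; last by exists 1 => t; exact: cos_max.
apply: measurableT_comp; last exact: measurable_funM.
by apply: continuous_measurable_fun; exact: continuous_cos.
Qed.

Lemma bm_sin (X : T -> R) (a : R) : measurable_fun setT X ->
  bm (fun t => sin (a * X t)).
Proof.
move=> mX; split; last by exists 1 => t; exact: sin_max.
apply: measurableT_comp; last exact: measurable_funM.
by apply: continuous_measurable_fun; exact: continuous_sin.
Qed.

Lemma bm_indic (A : set T) : measurable A -> bm (\1_A).
Proof.
move=> mA; split; first exact: measurable_indic.
by exists 1 => t; rewrite indicE; case: (t \in A); rewrite ?normr0 ?normr1.
Qed.

End bounded_measurable.

Lemma bm_comp d (T : measurableType d) (R : realType) (X : T -> R) (g : R -> R) :
  measurable_fun setT X -> bounded_measurable g -> bounded_measurable (g \o X).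
Proof.
by move=> mX [mg [M gM]]; split; [exact: measurableT_comp|exists M => t /=].
Qed.

Section expectation_of_bounded.
Context d (T : measurableType d) (R : realType) (P : probability T R).
Local Notation bm := (@bounded_measurable d T R).
Local Notation Ex := (Rintegral P setT).
Implicit Types U V W : T -> R.

Lemma bm_integrable W : bm W -> P.-integrable setT (EFin \o W).
Proof.
move=> [mW [M WM]]; apply: measurable_bounded_integrable => //.
  by apply: (le_lt_trans (probability_le1 P measurableT)); exact: ltry.
exists M; split; first exact: num_real.
by move=> N MN t _ /=; rewrite (le_trans (WM t))// ltW.
Qed.

Lemma ExD U V : bm U -> bm V -> Ex (fun t => U t + V t) = Ex U + Ex V.
Proof. by move=> hU hV; rewrite RintegralD//; exact: bm_integrable. Qed.

Lemma ExZ (k : R) U : bm U -> Ex (fun t => k * U t) = k * Ex U.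
Proof. by move=> hU; rewrite RintegralZl//; exact: bm_integrable. Qed.

Lemma Ex_lin (k l : R) U V : bm U -> bm V ->
  Ex (fun t => k * U t + l * V t) = k * Ex U + l * Ex V.
Proof.
by move=> hU hV; rewrite ExD ?ExZ//; apply: bmM => //; exact: bm_cst.
Qed.

Lemma Ex_cst (k : R) : Ex (cst k) = k.
Proof.
rewrite Rintegral_cst//; have -> : fine (P [set: T]) = 1 by rewrite probability_setT.
by rewrite mulr1.
Qed.

Lemma Ex_EFin W : bm W -> (\int[P]_t (W t)%:E = (Ex W)%:E)%E.
Proof.
move=> /bm_integrable iW; rewrite /Rintegral fineK//.
exact: integrable_fin_num.
Qed.

Lemma Ex_cvg (Un : nat -> T -> R) U (M : R) :
  (forall n, measurable_fun setT (Un n)) -> measurable_fun setT U ->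
  (forall n t, `|Un n t| <= M) ->
  (forall t, Un ^~ t @ \oo --> U t) -> Ex (Un n) @[n --> \oo] --> Ex U.
Proof.
move=> mUn mU UM cvgU.
have [||||_ _ H] := @dominated_convergence _ T R P _ measurableT
  (fun n t => (Un n t)%:E) (EFin \o U) (cst M%:E) _ _ _
  (bm_integrable (bm_cst _ M)) _.
- by move=> n; exact/measurable_EFinP.
- exact/measurable_EFinP.
- apply: aeW => t _; exact: (cvg_comp _ _ (cvgU t)).
- by apply: aeW => t n _; rewrite lee_fin.
have bU n : bm (Un n) by split; [exact: mUn|exists M].
have bU' : bm U.
  split=> //; exists M => t.
  by apply: (cvgr_to_le (cvg_norm (cvgU t))); exact: nearW.
move: H; rewrite Ex_EFin//.
by under eq_fun do rewrite Ex_EFin//; move/fine_cvg.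
Qed.

(** In other words, the image under [X] of the signed measure with density [W] has vanishing
    characteristic function. *)
Definition trig_null (X W : T -> R) := bm W /\ forall a,
  Ex (fun t => W t * cos (a * X t)) = 0 /\ Ex (fun t => W t * sin (a * X t)) = 0.

(* For fixed [X], the multipliers form an algebra closed under bounded pointwise
   limits and containing the trigonometric functions, hence all indicators of
   Borel sets; this is the uniqueness theorem for characteristic functions, with
   weights [W] instead of measures. *)
Definition multiplier (X : T -> R) (g : R -> R) := bounded_measurable g /\
  forall W, trig_null X W -> trig_null X (fun t => W t * g (X t)).

Section multipliers.
Variable X : T -> R.
Hypothesis mX : measurable_fun setT X.

Lemma multiplier_cst k : multiplier X (cst k).
Proof.
split; first exact: bm_cst.
move=> W [bW W0]; split; first by apply: bmM => //; exact: bm_cst.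
move=> a; have [c0 s0] := W0 a.
have bc := bmM bW (bm_cos a mX); have bs := bmM bW (bm_sin a mX).
split.
  by rewrite -[RHS](mulr0 k) -c0 -ExZ//; apply: eq_Rintegral => t _; rewrite /=; ring.
by rewrite -[RHS](mulr0 k) -s0 -ExZ//; apply: eq_Rintegral => t _; rewrite /=; ring.
Qed.

Lemma multiplierD g h : multiplier X g -> multiplier X h ->
  multiplier X (fun x => g x + h x).
Proof.
move=> [bg mg] [bh mh]; split; first exact: bmD.
move=> W W0; have [bW1 W1] := mg _ W0; have [bW2 W2] := mh _ W0; split.
  by under eq_fun do rewrite mulrDr; exact: bmD.
move=> a; have [c1 s1] := W1 a; have [c2 s2] := W2 a.
have bc := bm_cos a mX; have bs := bm_sin a mX.
split; under eq_Rintegral do rewrite mulrDr mulrDl.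
  by rewrite ExD ?c1 ?c2 ?addr0//; exact: bmM.
by rewrite ExD ?s1 ?s2 ?addr0//; exact: bmM.
Qed.

Lemma multiplierM g h : multiplier X g -> multiplier X h ->
  multiplier X (fun x => g x * h x).
Proof.
move=> [bg mg] [bh mh]; split; first exact: bmM.
move=> W W0; have := mh _ (mg _ W0).
by under eq_fun do rewrite -mulrA.
Qed.

Lemma multiplierX g n : multiplier X g -> multiplier X (fun x => g x ^+ n).
Proof.
move=> hg; elim: n => [|n IH].
  by under eq_fun do rewrite expr0; exact: multiplier_cst.
by under eq_fun do rewrite exprS; exact: multiplierM.
Qed.

Lemma multiplierC g : multiplier X g -> multiplier X (fun x => 1 - g x).
Proof.
move=> hg.
have := multiplierD (multiplier_cst 1) (multiplierM (multiplier_cst (-1)) hg).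
by under eq_fun do rewrite /= mulN1r.
Qed.

(** Product-to-sum formulas turn the test frequency [a] into [a + b] and [a - b], and the null
    condition holds at all frequencies. *)
Lemma multiplier_cos b : multiplier X (fun x => cos (b * x)).
Proof.
split; first exact: bm_cos.
move=> W [bW W0]; split; first by apply: bmM => //; exact: bm_cos.
move=> a; have [c1 s1] := W0 (a + b); have [c2 s2] := W0 (a - b).
have bc c := bmM bW (bm_cos c mX); have bs c := bmM bW (bm_sin c mX).
split.
  transitivity (2^-1 * Ex (fun t => W t * cos ((a + b) * X t)) +
                2^-1 * Ex (fun t => W t * cos ((a - b) * X t))).
    rewrite -Ex_lin//; apply: eq_Rintegral => t _.
    by rewrite mulrDl mulrBl cosD cosB; field.
  by rewrite c1 c2 !mulr0 addr0.
transitivity (2^-1 * Ex (fun t => W t * sin ((a + b) * X t)) +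
              2^-1 * Ex (fun t => W t * sin ((a - b) * X t))).
  rewrite -Ex_lin//; apply: eq_Rintegral => t _.
  by rewrite mulrDl mulrBl sinD sinB; field.
by rewrite s1 s2 !mulr0 addr0.
Qed.

Lemma multiplier_sin b : multiplier X (fun x => sin (b * x)).
Proof.
split; first exact: bm_sin.
move=> W [bW W0]; split; first by apply: bmM => //; exact: bm_sin.
move=> a; have [c1 s1] := W0 (a + b); have [c2 s2] := W0 (a - b).
have bc c := bmM bW (bm_cos c mX); have bs c := bmM bW (bm_sin c mX).
split.
  transitivity (2^-1 * Ex (fun t => W t * sin ((a + b) * X t)) +
                - 2^-1 * Ex (fun t => W t * sin ((a - b) * X t))).
    rewrite -Ex_lin//; apply: eq_Rintegral => t _.
    by rewrite mulrDl mulrBl sinD sinB; field.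
  by rewrite s1 s2 !mulr0 addr0.
transitivity (- 2^-1 * Ex (fun t => W t * cos ((a + b) * X t)) +
              2^-1 * Ex (fun t => W t * cos ((a - b) * X t))).
  rewrite -Ex_lin//; apply: eq_Rintegral => t _.
  by rewrite mulrDl mulrBl cosD cosB; field.
by rewrite c1 c2 !mulr0 addr0.
Qed.

Lemma multiplier_cvg (gn : nat -> R -> R) g (M : R) :
  (forall n, multiplier X (gn n)) -> (forall n x, `|gn n x| <= M) ->
  (forall x, gn ^~ x @ \oo --> g x) -> multiplier X g.
Proof.
move=> hgn gM cvgg.
have bg : bounded_measurable g.
  split.
    apply: (@measurable_fun_cvg _ _ _ _ gn) => // n.
    by have [[]] := hgn n.
  exists M => x.
  by apply: (cvgr_to_le (cvg_norm (cvgg x))); exact: nearW.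
split=> // W W0; have [bW _] := W0.
have bWg := bmM bW (bm_comp mX bg).
split=> // a.
(* The cosine and the sine test differ only in a bounded factor [u], so one limit argument covers
   both. *)
suff H (u : T -> R) : bm u -> (forall n, Ex (fun t => W t * gn n (X t) * u t) = 0) ->
    Ex (fun t => W t * g (X t) * u t) = 0.
  split; apply: H; [exact: bm_cos| |exact: bm_sin|].
    by move=> n; have [_ /(_ a)[]] := (hgn n).2 _ W0.
  by move=> n; have [_ /(_ a)[]] := (hgn n).2 _ W0.
move=> bu H0; have [mW [N WN]] := bW; have [mu [L uL]] := bu.
have : Ex (fun t => W t * gn n (X t) * u t) @[n --> \oo] -->
    Ex (fun t => W t * g (X t) * u t).
  apply: (@Ex_cvg _ _ (N * M * L)).
  - by move=> n; have [bgn _] := hgn n; have [] := bmM (bmM bW (bm_comp mX bgn)) bu.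
  - by have [] := bmM bWg bu.
  - by move=> n t; rewrite !normrM !ler_pM// ?mulr_ge0.
  - by move=> t; apply: cvgMr_tmp; apply: cvgMl_tmp; exact: cvgg.
under eq_fun do rewrite H0.
by move=> /cvg_lim => <-//; rewrite lim_cst.
Qed.

End multipliers.

End expectation_of_bounded.

(** * Polynomials converging to a threshold function *)

Section threshold.
Context (R : realType).
Implicit Types (q u : R) (n : nat).

Lemma expr_ge1Dn u n : 0 <= u -> 1 + n%:R * u <= (1 + u) ^+ n.
Proof.
move=> u0; elim: n => [|n IH]; first by rewrite mul0r addr0.
rewrite exprS; apply: le_trans (_ : (1 + u) * (1 + n%:R * u) <= _).
  rewrite -natr1 mulrDl mul1r mulrDr mulr1 mulrDl mul1r.
  have : 0 <= n%:R * u * u by rewrite !mulr_ge0.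
  lra.
by rewrite ler_wpM2l// addr_ge0.
Qed.

Lemma expr_ge1Bn u n : 0 <= u <= 1 -> 1 - n%:R * u <= (1 - u) ^+ n.
Proof.
move=> /andP[u0 u1]; elim: n => [|n IH]; first by rewrite mul0r subr0.
rewrite exprS; apply: le_trans (_ : (1 - u) * (1 - n%:R * u) <= _).
  have : 0 <= n%:R * u * u by rewrite !mulr_ge0.
  rewrite -natr1; lra.
by rewrite ler_wpM2l// subr_ge0.
Qed.

Lemma cvg_natr_mul_expr q : 0 <= q < 1 -> n%:R * q ^+ n @[n --> \oo] --> (0 : R).
Proof.
move=> /andP[q0 q1].
have [->|qN0] := eqVneq q 0.
  apply: cvg_near_cst; near=> n; rewrite expr0n (_ : (n == 0)%N = false) ?mulr0//.
  by apply/negbTE; rewrite -lt0n; near: n; exact: nbhs_infty_gt.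
have q_gt0 : 0 < q by rewrite lt_def qN0.
(* Write [q ^+ n] as [s ^+ n * s ^+ n]. Bernoulli's inequality for [s^-1 = 1 + h] bounds
   [n%:R * s ^+ n] by [h^-1], and the other factor tends to 0. *)
pose s := Num.sqrt q.
have s0 : 0 < s by rewrite sqrtr_gt0.
have s1 : s < 1 by rewrite -sqrtr1 ltr_sqrt.
pose h := s^-1 - 1.
have h0 : 0 < h by rewrite subr_gt0 invf_gt1.
have bound n : 0 <= n%:R * q ^+ n <= h^-1 * s ^+ n.
  rewrite mulr_ge0 ?exprn_ge0//= -(sqr_sqrtr q0) -/s -exprM mulnC exprM expr2 mulrA.
  rewrite ler_wpM2r ?exprn_ge0 ?(ltW s0)//.
  have := expr_ge1Dn n (ltW h0); rewrite /h addrCA subrr addr0 -/h exprVn => H.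
  rewrite -[leRHS]mul1r ler_pdivlMr//.
  rewrite mulrAC -ler_pdivlMr ?exprn_gt0// mul1r; apply: le_trans H.
  by rewrite lerDr.
apply: (@squeeze_cvgr _ _ _ _ (cst 0) (fun n => h^-1 * s ^+ n)).
- exact: nearW.
- exact: cvg_cst.
- rewrite -(mulr0 h^-1); apply: cvgMl_tmp; apply: cvg_expr.
  by rewrite ger0_norm// ltW.
Unshelve. all: end_near. Qed.

(* The exponent [n * 2 ^ n], rather than the usual [2 ^ n], makes the limit at
   the boundary point [u = 1 / 2] equal to 0. *)
Lemma threshold_cvg u : 0 <= u <= 1 ->
  (1 - u ^+ n) ^+ (n * 2 ^ n) @[n --> \oo] --> ((u < 2^-1)%R%:R : R).
Proof.
move=> /andP[u0 u1].
have un n : 0 <= u ^+ n <= 1 by rewrite exprn_ge0// exprn_ile1.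
have powE n : (n * 2 ^ n)%:R * u ^+ n = n%:R * (2 * u) ^+ n.
  by rewrite natrM natrX exprMn mulrA.
have ge0 n : 0 <= (1 - u ^+ n) ^+ (n * 2 ^ n).
  by rewrite exprn_ge0// subr_ge0; have /andP[] := un n.
(* Below 1/2, Bernoulli's inequality gives the lower bound [1 - n (2 u) ^ n], which tends to 1. From
   1/2 on, [1 - x <= expR (- x)] gives the upper bound [expR (- n (2 u) ^ n)], at most
   [expR (- n)]. *)
case: ltP => u2.
  apply: (@squeeze_cvgr _ _ _ _ (fun n => 1 - n%:R * (2 * u) ^+ n) (cst 1)).
  - apply: nearW => n; rewrite -powE expr_ge1Bn//= exprn_ile1// ?lerBlDr ?lerDl.
      by rewrite subr_ge0; have /andP[] := un n.
    by have /andP[] := un n.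
  - rewrite -[X in _ --> X]subr0; apply: cvgB; first exact: cvg_cst.
    apply: cvg_natr_mul_expr; rewrite mulr_ge0//= mulrC -ltr_pdivlMr//; lra.
  - exact: cvg_cst.
apply: (@squeeze_cvgr _ _ _ _ (cst 0) (fun n => expR (- n%:R))).
- apply: nearW => n; rewrite ge0/=.
  apply: (@le_trans _ _ (expR (- u ^+ n) ^+ (n * 2 ^ n))).
    apply: lerXn2r; rewrite ?nnegrE ?expR_ge0 ?expR_ge1Dx//.
    by rewrite subr_ge0; have /andP[] := un n.
  rewrite -expRM_natl ler_expR mulrN lerN2 powE ler_peMr// exprn_ege1//.
  by rewrite mulrC -ler_pdivrMr// mul1r.
- exact: cvg_cst.
- by apply: (cvg_comp _ (fun x : R => expR (- x)) (@cvgr_idn R)); exact: cvgr_expR.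
Qed.

End threshold.

Section multiplier_indic.
Context d (T : measurableType d) (R : realType) (P : probability T R).
Variable X : T -> R.
Hypothesis mX : measurable_fun setT X.
Local Notation mult := (multiplier P X).
Local Notation Ex := (Rintegral P setT).

Lemma multiplier_threshold g : mult g -> (forall x, 0 <= g x <= 1) ->
  mult (fun x => (g x < 2^-1)%R%:R).
Proof.
move=> hg g01.
apply: (@multiplier_cvg _ _ _ _ _ mX
  (fun n x => (1 - g x ^+ n) ^+ (n * 2 ^ n)) _ 1).
- by move=> n; do 2![apply: multiplierX => //; try apply: multiplierC => //].
- move=> n x; have /andP[g0 g1] := g01 x.
  have /andP[gn0 gn1] : 0 <= g x ^+ n <= 1 by rewrite exprn_ge0// exprn_ile1.
  by rewrite ger0_norm ?exprn_ge0 ?exprn_ile1 ?subr_ge0// lerBlDr lerDl.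
- by move=> x; exact: threshold_cvg.
Qed.

(** For large [n] the number [(x - p) / n.+1] lies in []-pi, pi[], where sine has the sign of its
    argument; thus thresholding [g n] at 1/2 eventually detects [x < p]. At [x = p] the value of
    [g n] is exactly 1/2, so the boundary case of [threshold_cvg] is met. *)
Lemma multiplier_ray p : mult (fun x => (x < p)%R%:R).
Proof.
pose g n x := 2^-1 * (1 + sin (n.+1%:R^-1 * (x - p))) : R.
have mg n : mult (g n).
  have -> : g n = (fun x => 2^-1 * (1 +
    (cos (n.+1%:R^-1 * p) * sin (n.+1%:R^-1 * x) +
    - sin (n.+1%:R^-1 * p) * cos (n.+1%:R^-1 * x)))).
    apply/funext => x; rewrite /g mulrBr sinB; congr (_ * (_ + _)); ring.
  apply: multiplierM => //; first exact: multiplier_cst.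
  apply: multiplierD => //; first exact: multiplier_cst.
  by apply: multiplierD => //; apply: multiplierM => //;
    (exact: multiplier_cst || exact: multiplier_sin || exact: multiplier_cos).
have g01 n x : 0 <= g n x <= 1.
  by have := sin_geN1 (n.+1%:R^-1 * (x - p));
     have := sin_le1 (n.+1%:R^-1 * (x - p)); rewrite /g; lra.
apply: (@multiplier_cvg _ _ _ _ _ mX (fun n x => (g n x < 2^-1)%R%:R) _ 1).
- by move=> n; exact: multiplier_threshold.
- by move=> n x; case: (_ < _); rewrite ?normr0 ?normr1.
move=> x; apply: cvg_near_cst; near=> n.
have small : `|n.+1%:R^-1 * (x - p)| < pi.
  rewrite normrM ger0_norm// mulrC ltr_pdivrMr// -ltr_pdivrMl ?pi_gt0//.
  apply: (@lt_le_trans _ _ n%:R); last by rewrite ler_nat.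
  by near: n; exact: nbhs_infty_gtr.
have -> : (g n x < 2^-1) = (sin (n.+1%:R^-1 * (x - p)) < 0) by rewrite /g; lra.
have n0 : 0 < n.+1%:R^-1 :> R by rewrite invr_gt0.
case: (ltP x p) => xp.
  have H : n.+1%:R^-1 * (x - p) < 0 by rewrite pmulr_rlt0// subr_lt0.
  rewrite -oppr_gt0 -sinN sin_gt0_pi//.
  by rewrite oppr_gt0 H/= -(ltr0_norm H).
have H : 0 <= n.+1%:R^-1 * (x - p) by rewrite pmulr_rge0// subr_ge0.
by rewrite ltNge sin_ge0_pi// H/= -(ger0_norm H) ltW.
Unshelve. all: end_near. Qed.

(** Closure under products makes the sets whose indicator is a multiplier a sigma-algebra outright,
    and open left rays generate the Borel sets. *)
Lemma multiplier_indic (A : set R) : measurable A -> mult \1_A.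
Proof.
have -> : (measurable A : Prop) = <<s RGenInftyO.G (R := R) >> A.
  by rewrite -[measurable]/((ocitv (R:=R)).-sigma.-measurable) RGenInftyO.measurableE.
move: A; apply: smallest_sub; last first.
  move=> _ [p ->] /=.
  have -> : \1_`]-oo, p[ = (fun x => (x < p)%R%:R) :> (R -> R).
    by apply/funext => x; rewrite indicE mem_setE in_itv.
  exact: multiplier_ray.
split => [|A mA|F mF] /=.
- by rewrite indic0; exact: multiplier_cst.
- have -> : \1_(setT `\` A) = (fun x => 1 - \1_A x) :> (R -> R).
    by apply/funext => x; rewrite setTD !indicE in_setC; case: (x \in A); rewrite ?subrr ?subr0.
  exact: multiplierC.
(* The indicator of the union of the first [n] sets; at each point it is eventually constant in
   [n]. *)
pose h n x := 1 - \prod_(i < n) (1 - \1_(F i) x) : R.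
have h01 n x : 0 <= \prod_(i < n) (1 - \1_(F i) x : R) <= 1.
  apply/andP; split.
    by apply: prodr_ge0 => i _; rewrite indicE; case: (_ \in _); rewrite ?subrr ?subr0.
  apply: prodr_ile1 => i _.
  by rewrite indicE; case: (_ \in _); rewrite ?subrr ?subr0 ?lexx ?ler01 //.
apply: (@multiplier_cvg _ _ _ _ _ mX h _ 1).
- move=> n; apply: multiplierC => //; elim: n => [|n IH].
    by under eq_fun do rewrite big_ord0; exact: multiplier_cst.
  under eq_fun do rewrite big_ord_recr/=.
  by apply: multiplierM => //; apply: multiplierC.
- move=> n x; have /andP[h0 h1] := h01 n x.
  by rewrite ger0_norm ?subr_ge0// lerBlDr lerDl.
move=> x; apply: cvg_near_cst; rewrite indicE.
have [/set_mem[i _ Fix]|xF] := boolP (x \in \bigcup_k F k).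
  near=> n; have ni : (i < n)%N by near: n; exact: nbhs_infty_gt.
  rewrite /h (bigD1 (Ordinal ni))//= indicE mem_set// subrr mul0r subr0//.
apply: nearW => n; rewrite /h big1 ?subrr// => i _.
rewrite indicE memNset ?subr0// => Fix; move/negP: xF; apply.
by apply: mem_set; exists (i : nat).
Unshelve. all: end_near. Qed.

(** The weight [W] times the indicator is null again; frequency 0 then tests its plain integral. *)
Lemma trig_null_indic W (A : set R) : trig_null P X W -> measurable A ->
  Ex (fun t => W t * \1_A (X t)) = 0.
Proof.
move=> W0 mA; have [_ /(_ 0)[+ _]] := (multiplier_indic mA).2 _ W0.
by under eq_Rintegral do rewrite mul0r cos0 mulr1.
Qed.

End multiplier_indic.

(** * Independence *)

Lemma ge0_integral_law d (T : measurableType d) (R : realType) (P : probability T R)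
    (Q : {measure set (measurableTypeR R) -> \bar R}) (X : T -> R) (f : R -> \bar R) :
  measurable_fun setT X -> (forall A, measurable A -> P (X @^-1` A) = Q A) ->
  measurable_fun setT f -> (forall x, (0 <= f x)%E) ->
  (\int[P]_t f (X t) = \int[Q]_x f x)%E.
Proof.
move=> mX lawX mf f0.
rewrite -[LHS](@ge0_integral_pushforward _ _ T (measurableTypeR R) R X mX P setT f)//.
by apply: eq_measure_integral => A mA _; rewrite -lawX.
Qed.

Section gaussian_pair.
Context d (T : measurableType d) (R : realType) (P : probability T R).
Variables X Z : T -> R.
Hypotheses (mX : measurable_fun setT X) (mZ : measurable_fun setT Z).
Hypothesis lawXZ : forall a b : R, a ^+ 2 + b ^+ 2 != 0 ->
  forall A, measurable A ->
  P ((fun t => a * X t + b * Z t) @^-1` A) =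
  normal_prob 0 (Num.sqrt (a ^+ 2 + b ^+ 2)) A.
Local Notation Ex := (Rintegral P setT).
Local Notation gamma := (normal_prob (0 : R) 1).

Let lawX A : measurable A -> P (X @^-1` A) = gamma A.
Proof.
move=> mA; have := lawXZ (a := 1) (b := 0); rewrite expr1n expr0n addr0 sqrtr1.
move=> /(_ (oner_neq0 _) _ mA) <-; congr (P _).
by apply/seteqP; split => t /=; rewrite mul1r mul0r addr0.
Qed.

Let lawZ A : measurable A -> P (Z @^-1` A) = gamma A.
Proof.
move=> mA; have := lawXZ (a := 0) (b := 1); rewrite expr1n expr0n add0r sqrtr1.
move=> /(_ (oner_neq0 _) _ mA) <-; congr (P _).
by apply/seteqP; split => t /=; rewrite mul1r mul0r add0r.
Qed.

Let mlin (a b : R) : measurable_fun setT (fun t => a * X t + b * Z t).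
Proof. by apply: measurable_funD; exact: measurable_funM. Qed.

Let bm1D W : bounded_measurable W -> bounded_measurable (fun t : T => 1 + W t : R).
Proof. by move=> bW; apply: bmD => //; exact: bm_cst. Qed.

Let Ex1D (W : T -> R) : bounded_measurable W -> Ex (fun t => 1 + W t) = 1 + Ex W.
Proof. by move=> bW; rewrite ExD ?Ex_cst//; exact: bm_cst. Qed.

(** Rotation invariance: the law of [a X + b Z] depends only on [a ^+ 2 + b ^+ 2]. The lower bound
    on [f] makes [1 + f] nonnegative, as [ge0_integral_law] requires. *)
Let Ex_same (a b a' b' : R) (f : R -> R) : bounded_measurable f ->
  (forall x, -1 <= f x) -> a ^+ 2 + b ^+ 2 != 0 ->
  a ^+ 2 + b ^+ 2 = a' ^+ 2 + b' ^+ 2 ->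
  Ex (fun t => f (a * X t + b * Z t)) = Ex (fun t => f (a' * X t + b' * Z t)).
Proof.
move=> bf f1 ab0 ab.
have bl c e := bm_comp (mlin c e) bf.
apply: (addrI 1); rewrite -!Ex1D; [|exact: bl..].
apply/EFin_inj; rewrite -!Ex_EFin; [|exact: bm1D (bl _ _)..].
have mf1 : measurable_fun setT (fun x => (1 + f x)%:E).
  by apply/measurable_EFinP; apply: measurable_funD => //; have [] := bf.
have f10 x : (0 <= (1 + f x)%:E)%E by rewrite lee_fin -lerBlDl sub0r.
rewrite (ge0_integral_law (Q := normal_prob (0 : R) (Num.sqrt (a ^+ 2 + b ^+ 2)))
  (mlin a b) _ mf1 f10); last by move=> A mA; rewrite lawXZ.
rewrite (ge0_integral_law (Q := normal_prob (0 : R) (Num.sqrt (a ^+ 2 + b ^+ 2)))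
  (mlin a' b') _ mf1 f10)//.
by move=> A mA; rewrite ab lawXZ// -ab.
Qed.

Let bcos : bounded_measurable (@cos R).
Proof.
split; last by exists 1 => x; exact: cos_max.
by apply: continuous_measurable_fun; exact: continuous_cos.
Qed.

Let bsin : bounded_measurable (@sin R).
Proof.
split; last by exists 1 => x; exact: sin_max.
by apply: continuous_measurable_fun; exact: continuous_sin.
Qed.

Let Ex_cos (a b : R) :
  Ex (fun t => cos (a * X t + b * Z t)) = expR (- ((a ^+ 2 + b ^+ 2) / 2)).
Proof.
have [ab0|ab0] := eqVneq (a ^+ 2 + b ^+ 2) 0.
  have /eqP := ab0; rewrite paddr_eq0 ?sqr_ge0// !sqrf_eq0 => /andP[/eqP-> /eqP->].
  under eq_Rintegral do rewrite !mul0r addr0 cos0.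
  by rewrite Ex_cst expr0n addr0 mul0r oppr0 expR0.
(* Rotating [(a, b)] onto the first axis leaves a multiple of [X] alone. *)
rewrite (Ex_same (a' := Num.sqrt (a ^+ 2 + b ^+ 2)) (b' := 0) bcos (@cos_geN1 R) ab0).
  set r := Num.sqrt _.
  under eq_Rintegral do rewrite mul0r addr0.
  apply: (addrI 1); rewrite -Ex1D; last exact: bm_cos.
  apply/EFin_inj; rewrite -Ex_EFin; last by apply: bm1D; exact: bm_cos.
  rewrite (ge0_integral_law (Q := gamma) (f := fun x => (1 + cos (r * x))%:E) mX lawX).
  - by rewrite integral_gaussian_cos sqr_sqrtr// addr_ge0 ?sqr_ge0.
  - apply/measurable_EFinP; apply: measurable_funD => //.
    have mr : measurable_fun setT ( *%R r) by exact: measurable_funM.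
    by have [] := bm_comp mr bcos.
  - by move=> x; rewrite lee_fin -lerBlDl sub0r cos_geN1.
by rewrite sqr_sqrtr ?addr_ge0 ?sqr_ge0// expr0n addr0.
Qed.

(** The coefficients [(a, b)] and [(- a, - b)] give the same law, while sine is odd. *)
Let Ex_sin (a b : R) : Ex (fun t => sin (a * X t + b * Z t)) = 0.
Proof.
have [ab0|ab0] := eqVneq (a ^+ 2 + b ^+ 2) 0.
  have /eqP := ab0; rewrite paddr_eq0 ?sqr_ge0// !sqrf_eq0 => /andP[/eqP-> /eqP->].
  under eq_Rintegral do rewrite !mul0r addr0 sin0.
  exact: Ex_cst.
have : Ex (fun t => sin (a * X t + b * Z t)) = - Ex (fun t => sin (a * X t + b * Z t)).
  rewrite {1}(Ex_same (a' := - a) (b' := - b) bsin (@sin_geN1 R) ab0) ?sqrrN//.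
  rewrite -[RHS]mulN1r -ExZ; last exact: (bm_comp (mlin a b) bsin).
  by apply: eq_Rintegral => t _; rewrite !mulNr -opprD sinN mul1r.
lra.
Qed.

Let Ex_prod_sum (k l a b : R) (f : R -> R) (W : T -> R) : bounded_measurable f ->
  (forall t, W t = k * f (a * X t + b * Z t) + l * f (a * X t + - b * Z t)) ->
  Ex W = k * Ex (fun t => f (a * X t + b * Z t)) +
         l * Ex (fun t => f (a * X t + - b * Z t)).
Proof.
move=> bf WE; rewrite -Ex_lin.
- by apply: eq_Rintegral => t _; exact: WE.
- exact: (bm_comp (mlin a b) bf).
- exact: (bm_comp (mlin a (- b)) bf).
Qed.

(** The subtracted constant is the mean of [cos (b * Z)], so being null expresses the factorization
    of the joint characteristic function. *)
Let null_cosZ (b : R) : trig_null P X (fun t => cos (b * Z t) - expR (- (b ^+ 2 / 2))).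
Proof.
have bc a := bm_cos a mX; have bs a := bm_sin a mX; have bz := bm_cos b mZ.
split; first by apply: bmD => //; exact: (bm_cst _ (- expR _)).
have XE f a : Ex (fun t => f (a * X t)) = Ex (fun t => f (a * X t + 0 * Z t)).
  by apply: eq_Rintegral => t _; rewrite mul0r addr0.
move=> a; set e := expR _.
have split_cst (W : T -> R) : bounded_measurable W ->
    Ex (fun t => (cos (b * Z t) - e) * W t) =
    1 * Ex (fun t => cos (b * Z t) * W t) + - e * Ex W.
  move=> bW; rewrite -Ex_lin//; last exact: bmM.
  by apply: eq_Rintegral => t _; ring.
split; rewrite split_cst//.
  rewrite (@Ex_prod_sum 2^-1 2^-1 a b (@cos R))//; last first.
    by move=> t; rewrite [- b * _]mulNr cosB cosD; field.
  rewrite (XE (@cos R)) !Ex_cos sqrrN expr0n/= addr0 /e mulNr -expRD.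
  have -> : - (b ^+ 2 / 2) + - (a ^+ 2 / 2) = - ((a ^+ 2 + b ^+ 2) / 2) :> R by field.
  by field.
rewrite (@Ex_prod_sum 2^-1 2^-1 a b (@sin R))//; last first.
  by move=> t; rewrite [- b * _]mulNr sinB sinD; field.
by rewrite (XE (@sin R)) !Ex_sin !mulr0 !addr0 mulr0.
Qed.

Let null_sinZ (b : R) : trig_null P X (fun t => sin (b * Z t)).
Proof.
split; first exact: bm_sin.
move=> a; split.
  rewrite (@Ex_prod_sum 2^-1 (- 2^-1) a b (@sin R))//; last first.
    by move=> t; rewrite [- b * _]mulNr sinB sinD; field.
  by rewrite !Ex_sin !mulr0 addr0.
rewrite (@Ex_prod_sum (- 2^-1) 2^-1 a b (@cos R))//; last first.
  by move=> t; rewrite [- b * _]mulNr cosB cosD; field.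
by rewrite !Ex_cos sqrrN; ring.
Qed.

Lemma gaussian_pair_indep (A B : set R) : measurable A -> measurable B ->
  P (X @^-1` A `&` Z @^-1` B) = (gamma A * gamma B)%E.
Proof.
move=> mA mB.
have bA : bounded_measurable (fun t => \1_A (X t) : R).
  by apply: (bm_comp mX); exact: bm_indic.
have bB : bounded_measurable (fun t => \1_B (Z t) : R).
  by apply: (bm_comp mZ); exact: bm_indic.
set pA := Ex (fun t => \1_A (X t)).
(* Exchange of roles: uniqueness in [X], with trigonometric weights in [Z], makes the centered
   indicator of [X] a null weight for [Z]. A second use of uniqueness, now in [Z], brings in [B]. *)
have null1A : trig_null P Z (fun t => \1_A (X t) - pA).
  split; first by apply: bmD => //; exact: (bm_cst _ (- pA)).
  move=> b.
  have bc := bm_cos b mZ; have bs := bm_sin b mZ.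
  have split_cst (W : T -> R) : bounded_measurable W ->
      Ex (fun t => (\1_A (X t) - pA) * W t) =
      1 * Ex (fun t => W t * \1_A (X t)) + - pA * Ex W.
    move=> bW; rewrite -Ex_lin//; last exact: bmM.
    by apply: eq_Rintegral => t _; ring.
  have Z0 f : Ex (fun t => f (b * Z t)) = Ex (fun t => f (0 * X t + b * Z t)).
    by apply: eq_Rintegral => t _; rewrite mul0r add0r.
  split; rewrite split_cst//.
    have := trig_null_indic mX (null_cosZ b) mA; set e := expR _.
    have -> : Ex (fun t => (cos (b * Z t) - e) * \1_A (X t)) =
        1 * Ex (fun t => cos (b * Z t) * \1_A (X t)) + - e * pA.
      rewrite -Ex_lin//; last exact: bmM.
      by apply: eq_Rintegral => t _; ring.
    by move=> <-; rewrite (Z0 (@cos R)) Ex_cos expr0n/= add0r -/e; ring.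
  by rewrite (trig_null_indic mX (null_sinZ b) mA) (Z0 (@sin R)) Ex_sin !mulr0 addr0.
have := trig_null_indic mZ null1A mB.
have -> : Ex (fun t => (\1_A (X t) - pA) * \1_B (Z t)) =
    1 * Ex (fun t => \1_A (X t) * \1_B (Z t)) + - pA * Ex (fun t => \1_B (Z t)).
  rewrite -Ex_lin//; last exact: bmM.
  by apply: eq_Rintegral => t _; ring.
rewrite mul1r mulNr => /subr0_eq indep.
have mXA : measurable (X @^-1` A) by rewrite -[_ @^-1` _]setTI; exact: mX.
have mZB : measurable (Z @^-1` B) by rewrite -[_ @^-1` _]setTI; exact: mZ.
have ExI C : measurable C -> (Ex \1_C)%:E = P C.
  by move=> mC; rewrite -Ex_EFin ?integral_indic ?setIT//; exact: bm_indic.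
have -> : P (X @^-1` A `&` Z @^-1` B) = (Ex (fun t => \1_A (X t) * \1_B (Z t)))%:E.
  rewrite -ExI; last exact: measurableI.
  by congr (_%:E); apply: eq_Rintegral => t _; rewrite in_setI -mulnb natrM !indicE.
apply: etrans (congr1 EFin indep) _.
by rewrite EFinM -lawX// -lawZ// -!ExI.
Qed.

End gaussian_pair.

(** * Gaussian integrals of absolute values *)

Section half_line_integrals.
Context (R : realType).
Local Notation mu := (@lebesgue_measure R).
Local Notation phi := (@phi R).
Local Notation gamma := (normal_prob (0 : R) 1).

Lemma ge0_is_derive_FTC2y (f F : R -> R) (a l : R) :
  (forall x, a <= x -> 0 <= f x) -> continuous f ->
  (forall x : R, is_derive x (1 : R) F (f x)) -> F x @[x --> +oo] --> l ->
  (\int[mu]_(x in `[a, +oo[) (f x)%:E = (l - F a)%:E)%E.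
Proof.
move=> f0 cf dF Fl; rewrite (@ge0_continuous_FTC2y _ f F a l)//.
- exact: continuous_subspaceT.
- apply: cvg_at_right_filter; apply: differentiable_continuous.
  by apply/derivable1_diffP; have [] := dF a.
- by move=> x _; rewrite derive1E; have [_ ->] := dF x.
Qed.

Lemma ge0_integral_split (h : R -> R) (a : R) : continuous h -> (forall x, 0 <= h x) ->
  (\int[mu]_x (h x)%:E = \int[mu]_(x in `[a, +oo[) (h x)%:E
                       + \int[mu]_(x in `[(- a)%R, +oo[) (h (- x))%:E)%E.
Proof.
move=> ch h0.
have mh D : measurable_fun D (EFin \o h).
  by apply/measurable_EFinP/measurable_funTS; exact: continuous_measurable_fun.
rewrite -(setUv `[a, +oo[%classic) ge0_integral_setU//=; last 4 first.
- exact: measurableC.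
- exact: mh.
- by move=> x _; rewrite lee_fin.
- exact/disj_setPCl.
congr (_ + _)%E; rewrite setCitvr integral_itv_bndo_bndc; last exact: mh.
rewrite -{1}[a]opprK ge0_integration_by_substitutionNy//.
exact: continuous_subspaceT.
Qed.

Lemma ge0_integral_Uset (h : R -> R) (a : R) : 0 <= a -> continuous h ->
  (forall x, 0 <= h x) -> (forall x, h (- x) = h x) ->
  (\int[mu]_(x in Uset a) (h x)%:E = 2%:E * \int[mu]_(x in `[a, +oo[) (h x)%:E)%E.
Proof.
move=> a0 ch h0 hN.
have mh D : measurable_fun D (EFin \o h).
  by apply/measurable_EFinP/measurable_funTS; exact: continuous_measurable_fun.
rewrite /Uset ge0_integral_setU//=; last 3 first.
- exact: mh.
- by move=> x _; rewrite lee_fin.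
- apply/disj_setPS => x [/=]; rewrite !in_itv/= andbT => x1 x2; lra.
rewrite integral_itv_obnd_cbnd; last exact: mh.
rewrite integral_itv_bndo_bndc; last exact: mh.
rewrite ge0_integration_by_substitutionNy//; last exact: continuous_subspaceT.
rewrite mule_natl mule2n; congr (_ + _)%E.
by apply: eq_integral => x _; rewrite /= hN.
Qed.

Lemma normal_prob_Uset (a : R) : 0 <= a ->
  gamma (Uset a) = (1 - erf (a / Num.sqrt 2))%:E.
Proof.
move=> a0; rewrite /normal_prob -phiE ge0_integral_Uset//.
- rewrite (@ge0_is_derive_FTC2y _ _ a 2^-1 _ _ (@is_derive_half_erf R)).
  + by rewrite -EFinM [a / _]mulrC; congr (_%:E); field.
  + by move=> x _; exact: phi_ge0.
  + exact: continuous_phi.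
  + rewrite -[X in _ --> X]mulr1; apply: cvgMl_tmp; apply: cvg_erf_muly.
    by rewrite invr_gt0 sqrt2_gt0.
- exact: continuous_phi.
- exact: phi_ge0.
- exact: phiN.
Qed.

(** The upper bound holds because [1 - erf y] is twice a Gaussian tail; oddness gives the lower
    one. *)
Lemma erf_le1 (x : R) : `|erf x| <= 1.
Proof.
have erf1 (y : R) : erf y <= 1.
  have : 0 <= Rintegral mu `[Num.sqrt 2 * y, +oo[ phi.
    by apply: Rintegral_ge0 => t _; exact: phi_ge0.
  rewrite Rintegral_phiy mulKf ?gt_eqF ?sqrt2_gt0//.
  by rewrite pmulr_rge0// subr_ge0.
by rewrite ler_norml erf1 lerNl -erfN erf1.
Qed.

Lemma continuous_erf_mul (c : R) : continuous (fun x => erf (c * x)).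
Proof.
move=> x; apply: (continuous_comp (f := *%R c)); last exact: continuous_erf.
exact: mulrl_continuous.
Qed.

Lemma integral_affine_phi (m s a : R) : (forall y, a <= y -> 0 <= m + s * y) ->
  (\int[mu]_(y in `[a, +oo[) ((m + s * y) * phi y)%:E =
   (s * phi a + m / 2 * (1 - erf ((Num.sqrt 2)^-1 * a)))%:E)%E.
Proof.
move=> ge0.
pose F y := m * (2^-1 * erf ((Num.sqrt 2)^-1 * y)) + - s * phi y.
have dF x : is_derive x (1 : R) F ((m + s * x) * phi x).
  apply: (is_derive_eq (is_derive_add (is_derive_scale m (is_derive_half_erf x))
    (is_derive_scale (- s) (is_derive_phi x)))); ring.
rewrite (@ge0_is_derive_FTC2y _ F a (m * (2^-1 * 1) + - s * 0) _ _ dF).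
- by rewrite /F; congr (_%:E); field.
- by move=> x /ge0 ?; rewrite mulr_ge0 ?phi_ge0.
- move=> x; apply: cvgM; last exact: continuous_phi.
  by apply: cvgD; [exact: cvg_cst|exact: mulrl_continuous].
- apply: cvgD; apply: cvgMl_tmp; last exact: cvg_phiy.
  by apply: cvgMl_tmp; apply: cvg_erf_muly; rewrite invr_gt0 sqrt2_gt0.
Qed.

(** The mean of a folded normal law. Splitting at the zero [- (m / s)] of the affine function and
    reflecting the lower half gives two integrals of [integral_affine_phi], with [m] and [- m]. *)
Lemma integral_abs_affine_normal (m s : R) : 0 < s ->
  (\int[gamma]_y `|m + s * y|%:E =
   (2 * s * phi (m / s) + m * erf ((Num.sqrt 2)^-1 * (m / s)))%:E)%E.
Proof.
move=> s0.
have cabs : continuous (fun y : R => `|m + s * y|).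
  move=> y; apply: cvg_norm; apply: cvgD; [exact: cvg_cst|exact: mulrl_continuous].
have ch : continuous (fun y => `|m + s * y| * phi y).
  by move=> y; apply: cvgM; [exact: cabs|exact: continuous_phi].
rewrite integral_std_normal//; last first.
  by apply/measurable_EFinP; exact: continuous_measurable_fun.
under eq_integral do rewrite -EFinM.
rewrite (ge0_integral_split (- (m / s)) ch); last first.
  by move=> y; rewrite mulr_ge0 ?phi_ge0.
have ge0 e y : - (e / s) <= y -> 0 <= e + s * y.
  move=> ey; rewrite -[e in e + _](divfK (lt0r_neq0 s0)) mulrC -mulrDr.
  by rewrite mulr_ge0 ?(ltW s0)// -lerBlDl sub0r.
have -> : (\int[mu]_(y in `[(- (m / s))%R, +oo[) (`|m + s * y| * phi y)%:E =
    \int[mu]_(y in `[(- (m / s))%R, +oo[) ((m + s * y) * phi y)%:E)%E.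
  apply: eq_integral => y; rewrite inE/= in_itv/= andbT => /ge0 H.
  by rewrite ger0_norm.
have -> : (\int[mu]_(y in `[(- - (m / s))%R, +oo[) (`|m + s * - y| * phi (- y))%:E =
    \int[mu]_(y in `[(- (- m / s))%R, +oo[) ((- m + s * y) * phi y)%:E)%E.
  rewrite mulNr; apply: eq_integral => y; rewrite inE/= in_itv/= andbT -mulNr => /ge0 H.
  by rewrite phiN -normrN opprD mulrN opprK ger0_norm.
rewrite !integral_affine_phi; [|exact: ge0..].
rewrite -EFinD !mulNr opprK phiN mulrN erfN; congr (_%:E); field.
by [].
Qed.

(** The integrand is the folded normal mean at [m = r * x], that is, the inner integral in Fubini's
    theorem. *)
Lemma integral_Uset_abs_affine (r s a : R) : 0 <= a -> 0 < s -> r ^+ 2 + s ^+ 2 = 1 ->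
  (\int[gamma]_(x in Uset a) (2 * s * phi (r * x / s) +
      r * x * erf ((Num.sqrt 2)^-1 * (r * x / s)))%:E =
   (Num.sqrt (2 / pi) * (1 - erf (a / Num.sqrt 2 / s) +
      r * erf (r * (a / Num.sqrt 2) / s) * expR (- (a / Num.sqrt 2) ^+ 2)))%:E)%E.
Proof.
move=> a0 s0 rs.
pose c := (Num.sqrt 2)^-1 / s; pose e := (Num.sqrt 2)^-1 * (r / s).
pose g x := 2 * s * phi (r / s * x) + r * x * erf (e * x).
have gE x : 2 * s * phi (r * x / s) + r * x * erf ((Num.sqrt 2)^-1 * (r * x / s)) = g x.
  by rewrite /g /e (_ : r * x / s = r / s * x) ?[(Num.sqrt 2)^-1 * (_ * x)]mulrA// mulrAC.
under eq_integral do rewrite gE.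
have cg : continuous g.
  move=> x; apply: cvgD; apply: cvgM.
  - exact: cvg_cst.
  - apply: (continuous_comp (f := *%R (r / s))); last exact: continuous_phi.
    exact: mulrl_continuous.
  - exact: mulrl_continuous.
  - exact: continuous_erf_mul.
have g0 x : 0 <= g x.
  rewrite -lee_fin -gE -integral_abs_affine_normal//.
  by apply: integral_ge0 => y _; rewrite lee_fin.
have cgphi : continuous (fun x => g x * phi x).
  by move=> x; apply: cvgM; [exact: cg|exact: continuous_phi].
rewrite integral_std_normal//; last 2 first.
- by apply: measurableU.
- by apply/measurable_EFinP/measurable_funTS; exact: continuous_measurable_fun.
under eq_integral do rewrite -EFinM.
rewrite ge0_integral_Uset//; last 2 first.
- by move=> x; rewrite mulr_ge0 ?phi_ge0.
- by move=> x; rewrite phiN /g !mulrN phiN erfN mulrNN.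
(* [K] is an antiderivative of [g * phi] because [r ^+ 2 + s ^+ 2 = 1]. *)
pose k := Num.sqrt 2 / Num.sqrt pi / 2 : R.
pose K x := k * erf (c * x) + - r * (erf (e * x) * phi x).
have sqrt2N0 : Num.sqrt 2 != 0 :> R by rewrite gt_eqF// sqrt2_gt0.
have sqrtpiN0 : Num.sqrt pi != 0 :> R by rewrite gt_eqF// sqrtpi_gt0.
have sN0 : s != 0 by rewrite gt_eqF.
have sqr2 : Num.sqrt 2 ^+ 2 = 2 :> R by rewrite sqr_sqrtr.
have dK x : is_derive x (1 : R) K (g x * phi x).
  apply: (is_derive_eq (is_derive_add
    (is_derive_scale k (is_derive_comp_mul (is_derive_erf _)))
    (is_derive_scale (- r) (is_derive_mul (is_derive_comp_mul (is_derive_erf _))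
      (is_derive_phi x))))).
  rewrite /g !phi_sqrt.
  (* As [1 / s ^+ 2 = r ^+ 2 / s ^+ 2 + 1], the Gaussian produced by [erf (c * x)] is the product of
     those from [erf (e * x)] and [phi], so the terms can be combined. *)
  have -> : - (c * x) ^+ 2 = - (e * x) ^+ 2 - x ^+ 2 / 2.
    have r2 : r ^+ 2 = 1 - s ^+ 2 by rewrite -rs addrK.
    by rewrite /c /e !exprMn !exprVn sqr2 r2; field.
  have -> : - ((r / s * x) ^+ 2 / 2) = - (e * x) ^+ 2.
    by rewrite /e !exprMn !exprVn sqr2; field.
  rewrite expRD /k /c /e; set u := expR _; set v := expR _; set w := erf _.
  (* For [field] the square root of 2 is an atom and [rs] is unknown; the difference is factored so
     that both relations enter in a single vanishing factor. *)
  apply: subr0_eq; rewrite (_ : _ - _ = u * v / (Num.sqrt pi ^+ 2 * s) *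
    (1 - 2 / Num.sqrt 2 ^+ 2 * (r ^+ 2 + s ^+ 2))).
    by rewrite rs sqr2 mulr1 divff// subrr mulr0.
  by field; rewrite sqrt2N0 sqrtpiN0 sN0.
have Klim : K x @[x --> +oo] --> k * 1 + - r * 0.
  apply: cvgD; apply: cvgMl_tmp.
    by apply: cvg_erf_muly; rewrite divr_gt0 ?invr_gt0 ?sqrt2_gt0.
  by apply: (cvg_bounded_mul_phiy (M := 1)) => x; exact: erf_le1.
rewrite (@ge0_is_derive_FTC2y _ K a (k * 1 + - r * 0) _ cgphi dK)//; last first.
  by move=> x _; rewrite mulr_ge0 ?phi_ge0.
rewrite -EFinM /K; congr (_%:E).
rewrite phi_sqrt sqrtrM// sqrtrV ?pi_ge0//.
have -> : c * a = a / Num.sqrt 2 / s by rewrite /c; field; rewrite sqrt2N0 sN0.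
have -> : e * a = r * (a / Num.sqrt 2) / s by rewrite /e; field; rewrite sqrt2N0 sN0.
have -> : - (a ^+ 2 / 2) = - (a / Num.sqrt 2) ^+ 2 by rewrite exprMn exprVn sqr2.
set u := erf _; set v := erf _; set w := expR _.
apply: subr0_eq; rewrite (_ : _ - _ = r * v * w / (Num.sqrt 2 * Num.sqrt pi) *
  (2 - Num.sqrt 2 ^+ 2)); first by rewrite sqr2 subrr mulr0.
by rewrite /k; field; rewrite sqrt2N0 sqrtpiN0.
Qed.

End half_line_integrals.

Lemma measurable_Uset (R : realType) (a : R) : measurable (Uset a).
Proof. exact: measurableU. Qed.

Section gaussian_pair_expectation.
Context d (T : measurableType d) (R : realType) (P : probability T R).
Variables X Z : T -> R.
Hypotheses (mX : measurable_fun setT X) (mZ : measurable_fun setT Z).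
Hypothesis lawXZ : forall a b : R, a ^+ 2 + b ^+ 2 != 0 ->
  forall A, measurable A ->
  P ((fun t => a * X t + b * Z t) @^-1` A) =
  normal_prob 0 (Num.sqrt (a ^+ 2 + b ^+ 2)) A.
Local Notation gamma := (normal_prob (0 : R) 1).

Lemma gaussian_pair_Uset_expectation (r s a : R) :
  0 <= a -> 0 < s -> r ^+ 2 + s ^+ 2 = 1 ->
  (\int[P]_(t in X @^-1` Uset a) `|r * X t + s * Z t|%:E =
   (Num.sqrt (2 / pi) * (1 - erf (a / Num.sqrt 2 / s) +
      r * erf (r * (a / Num.sqrt 2) / s) * expR (- (a / Num.sqrt 2) ^+ 2)))%:E)%E.
Proof.
move=> a0 s0 rs.
pose XZ t := (X t, Z t) : measurableTypeR R * measurableTypeR R.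
have mXZ : measurable_fun setT XZ by exact: measurable_fun_pair.
pose f (p : measurableTypeR R * measurableTypeR R) : \bar R := `|r * p.1 + s * p.2|%:E.
pose D : set (measurableTypeR R * measurableTypeR R) := Uset a `*` setT.
have mD : measurable D by apply: measurableX => //; exact: measurable_Uset.
have mf : measurable_fun setT f.
  apply/measurable_EFinP; apply: measurableT_comp => //.
  by apply: measurable_funD; apply: measurable_funM.
have f0 p : (0 <= f p)%E by rewrite lee_fin.
transitivity (\int[pushforward P XZ]_(p in D) f p)%E.
  rewrite ge0_integral_pushforward//; last exact: measurable_funTS.
  by congr integral; apply/seteqP; split => t //= [].
(* Independence gives equality on measurable rectangles, which determines the joint law. *)
transitivity (\int[gamma \x gamma]_(p in D) f p)%E.
  apply: eq_measure_integral => A mA _; apply/esym.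
  apply: product_measure_unique => // B C mB mC.
  by rewrite -(gaussian_pair_indep mX mZ lawXZ mB mC).
rewrite integral_mkcond fubini_tonelli1; last 2 first.
- by apply/(measurable_restrictT _ _).1 => //; exact: measurable_funTS.
- by move=> p; rewrite patchE; case: ifPn.
rewrite -(integral_Uset_abs_affine a0 s0 rs) [RHS]integral_mkcond.
apply: eq_integral => x _; rewrite /fubini_F.
rewrite patchE; case: ifPn => xU.
  rewrite -integral_abs_affine_normal//; apply: eq_integral => y _.
  by rewrite patchE ifT//; rewrite inE; split => //; rewrite inE in xU.
apply: integral0_eq => y _; rewrite patchE ifF//.
by apply/negbTE; apply: contra xU; rewrite !inE => -[].
Qed.

End gaussian_pair_expectation.

(** * Centered Gaussian vectors *)

Section quadratic_forms.
Context (R : realType) (n : nat).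
Implicit Types (S : 'M[R]_n) (i j : 'I_n).

(** A sum of two indicators instead of a case distinction, so that [i = j] is allowed: a single
    coordinate is the case [i = j], [b = 0]. *)
Definition two_coords i j (a b : R) : 'I_n -> R :=
  fun k => a * (k == i)%:R + b * (k == j)%:R.

Lemma sum_two_coords i j (a b : R) (f : 'I_n -> R) :
  \sum_(k < n) two_coords i j a b k * f k = a * f i + b * f j.
Proof.
have delta (l : 'I_n) c : \sum_(k < n) c * (k == l)%:R * f k = c * f l.
  rewrite (bigD1 l)//= eqxx mulr1 big1 ?addr0// => k /negbTE->.
  by rewrite mulr0 mul0r.
by under eq_bigr do rewrite mulrDl; rewrite big_split/= !delta.
Qed.

Lemma quad_two_coords S i j (a b : R) : S j i = S i j ->
  quad S (two_coords i j a b) =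
  a ^+ 2 * S i i + 2 * a * b * S i j + b ^+ 2 * S j j.
Proof.
move=> Sji; rewrite /quad.
under eq_bigr => k _.
  under eq_bigr => l _ do rewrite mulrC.
  rewrite sum_two_coords.
  rewrite (_ : _ + _ = two_coords i j a b k * (a * S k i + b * S k j)); last by ring.
  over.
by rewrite sum_two_coords Sji; ring.
Qed.

End quadratic_forms.

Section centered_gaussian.
Context (R : realType) (n : nat) (P : probability (n.-tuple R) R) (S : 'M[R]_n).
Hypothesis gaussP : is_centered_gaussian P S.
Local Notation gamma := (normal_prob (0 : R) 1).

Let symS a b : S a b = S b a.
Proof. by case: gaussP => /matrixP/(_ b a); rewrite mxE. Qed.

(** At deviation 0, [normal_pdf] takes the indicator of [[0, 1]] as its default value. *)
Lemma normal_prob0_pos : normal_prob (0 : R) 0 `]0, +oo[%classic = 1%E.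
Proof.
rewrite /normal_prob /normal_pdf eqxx integral_indic//.
rewrite (_ : _ `&` _ = `]0, 1]%classic); last first.
  apply/seteqP; split => x /=; rewrite !in_itv/= ?andbT.
    by move=> [/andP[_ ->] ->].
  by move=> /andP[x0 ->]; rewrite x0 ltW.
apply: etrans (lebesgue_measure_itv (Interval (BRight 0) (BRight 1))) _.
by rewrite /= lte_fin ltr01 oppr0 adde0.
Qed.

(* [normal_prob 0 0] is the uniform law on [0, 1], which is not symmetric; so
   a Gaussian matrix cannot take a negative value on the diagonal. *)
Lemma quad_ge0 u : 0 <= quad S u.
Proof.
rewrite leNgt; apply/negP => q0; have [_ law] := gaussP.
have mpos : measurable (`]0, +oo[%classic : set R) by exact: measurable_itv.
have qN : quad S (fun k => - u k) = quad S u.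
  by apply: eq_bigr => a _; apply: eq_bigr => b _; ring.
(* [Num.sqrt] of a negative number is 0, so the forms of [u] and [- u] would both be positive with
   probability 1, although these events are disjoint. *)
have P1 v : quad S v = quad S u ->
    P [set y | `]0, +oo[%classic (\sum_(a < n) v a * tnth y a)] = 1%E.
  move=> qv; rewrite law// qv lt_eqF// ltr0_sqrtr//.
  exact: normal_prob0_pos.
have mlin v : measurable_fun setT (fun y : n.-tuple R => \sum_(a < n) v a * tnth y a).
  by apply: measurable_sum => a; apply: measurable_funM => //; exact: measurable_tnth.
have mP v : measurable [set y : n.-tuple R | `]0, +oo[%classic (\sum_(a < n) v a * tnth y a)].
  by rewrite -[X in measurable X]setTI; exact: mlin.
pose L v := [set y : n.-tuple R | `]0, +oo[%classic (\sum_(a < n) v a * tnth y a)].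
have disj : L u `&` L (fun k => - u k) = set0.
  apply/seteqP; split => // y [].
  rewrite /L /= !in_itv/= !andbT => h1.
  have -> : \sum_(a < n) - u a * tnth y a = - \sum_(a < n) u a * tnth y a.
    by rewrite -sumrN; apply: eq_bigr => a _; rewrite mulNr.
  by move: h1; lra.
have PU : P (L u `|` L (fun k => - u k)) = (1 + 1)%E.
  rewrite -{1}(P1 _ erefl) -(P1 _ qN); apply: measureU => //; exact: mP.
have := probability_le1 P (measurableU _ _ (mP u) (mP (fun k => - u k))).
by rewrite leNgt PU -EFinD lte_fin ltrDl ltr01.
Qed.

Lemma gaussian_two_coords i j (a b : R) (A : set R) : measurable A ->
  let q := a ^+ 2 * S i i + 2 * a * b * S i j + b ^+ 2 * S j j in
  P [set y | A (a * tnth y i + b * tnth y j)] =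
  if q == 0 then \d_(0 : R) A else normal_prob 0 (Num.sqrt q) A.
Proof.
move=> mA q; have [_ /(_ (two_coords i j a b) A mA)] := gaussP.
rewrite quad_two_coords// => <-; congr (P _).
by apply/seteqP; split => y /=; rewrite sum_two_coords.
Qed.

Lemma gaussian_coord i (A : set R) : measurable A ->
  P [set y | A (tnth y i)] =
  if S i i == 0 then \d_(0 : R) A else normal_prob 0 (Num.sqrt (S i i)) A.
Proof.
move=> mA; have := gaussian_two_coords i i 1 0 mA; cbv zeta.
rewrite (_ : _ + _ = S i i); last by ring.
move=> <-; congr (P _).
by apply/seteqP; split => y /=; rewrite mul1r mul0r addr0.
Qed.

Lemma cov_form_ge0 i j (a b : R) :
  0 <= a ^+ 2 * S i i + 2 * a * b * S i j + b ^+ 2 * S j j.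
Proof. by rewrite -quad_two_coords// quad_ge0. Qed.

Lemma variance_ge0 i : 0 <= S i i.
Proof.
suff -> : S i i = 1 ^+ 2 * S i i + 2 * 1 * 0 * S i i + 0 ^+ 2 * S i i.
  exact: cov_form_ge0.
by ring.
Qed.

End centered_gaussian.

(** Transfers positivity between two matrices representing the same [P]: zero variance puts mass 1
    at 0, while positive variance gives an absolutely continuous law without atoms. *)
Lemma variance_gt0 (R : realType) (n : nat) (P : probability (n.-tuple R) R)
    (S S' : 'M[R]_n) (i : 'I_n) :
  is_centered_gaussian P S -> is_centered_gaussian P S' -> 0 < S' i i -> 0 < S i i.
Proof.
move=> gS gS' S'0; rewrite lt_def (variance_ge0 gS) andbT; apply/eqP => Si0.
have m0 : measurable [set 0 : R] by exact: measurable_set1.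
have := gaussian_coord gS i m0; rewrite Si0 eqxx (gaussian_coord gS' i m0) gt_eqF//.
have -> : normal_prob 0 (Num.sqrt (S' i i)) [set (0 : R)] = 0%E.
  have /null_content_dominatesP := normal_prob_dominates (0 : R) (Num.sqrt (S' i i)).
  by apply => //; exact: lebesgue_measure_set1.
by rewrite diracE mem_set// => /esym/eqP; rewrite eqe oner_eq0.
Qed.

(** * The nominal covariance and the conditional mean *)

Section steady_covariance.
Context (R : realType) (n : nat).

Lemma psi_gt0 (tau lam : R) : 0 < lam -> 0 <= tau -> lam * tau < pi / 2 ->
  0 < psi tau lam.
Proof.
move=> lam0 tau0 lt.
have cos0 : 0 < cos (lam * tau).
  apply: cos_gt0_pihalf; rewrite lt andbT.
  by rewrite (@lt_le_trans _ _ 0) ?mulr_ge0 ?(ltW lam0)// oppr_lt0 divr_gt0 ?pi_gt0.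
have sin1 : sin (lam * tau) < 1.
  rewrite lt_neqAle sin_le1 andbT; apply/eqP => s1.
  have := cos2Dsin2 (lam * tau); rewrite s1.
  by have : 0 < cos (lam * tau) ^+ 2; [exact: exprn_gt0|lra].
by rewrite /psi divr_gt0// mulr_gt0 ?subr_gt0// mulr_gt0.
Qed.

Lemma diag_congruence (B : 'M[R]_n) (D : 'rV[R]_n) (i : 'I_n) :
  (B *m diag_mx D *m B^T) i i = \sum_a D 0 a * B i a ^+ 2.
Proof.
rewrite !mxE; apply: eq_bigr => a _.
rewrite !mxE (bigD1 a)//= !mxE eqxx mulr1n big1 ?addr0; first ring.
by move=> b /negbTE ba; rewrite !mxE ba mulr0n mulr0.
Qed.

Lemma steady_cov_gt0 (b tau : R) (k Q : 'M[R]_n) (lam : 'I_n -> R) (i : 'I_n) :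
  (2 <= n)%N -> nominal_params b tau k Q lam -> 0 < steady_cov b tau Q lam i i.
Proof.
move=> n2 [b0 [tau0 [_ [QQ [_ [Q1 [_ [lam_gt0 [lam_mono lam_lt]]]]]]]]].
have n0 : n%:R != 0 :> R by rewrite pnatr_eq0 -lt0n ltnW.
have last_lt : (n.-1 < n)%N by rewrite prednK// ltnW.
pose m := Ordinal last_lt.
have psi0 (a : 'I_n) : val a != 0%N -> 0 < psi tau (lam a).
  rewrite -lt0n => a0; apply: psi_gt0 => //; first exact: lam_gt0.
  have m0 : 0 < lam m by apply: lam_gt0; rewrite /= -subn1 subn_gt0.
  have am : lam a <= lam m.
    by apply: lam_mono; rewrite /= -ltnS prednK// ltnW.
  have := lam_lt m erefl; rewrite ltr_pdivlMr ?mulr_gt0// => H.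
  have := ler_wpM2r tau0 am; lra.
pose C : 'M[R]_n := centering R n.
have CT : C^T = C.
  by apply/matrixP => x y; rewrite !mxE eq_sym.
pose B := C *m Q.
pose D : 'rV[R]_n := \row_a (if val a == 0%N then 0 else psi tau (lam a)).
have -> : steady_cov b tau Q lam i i = b ^+ 2 * \sum_a D 0 a * B i a ^+ 2.
  by rewrite -diag_congruence /steady_cov mxE /B trmx_mul CT !mulmxA.
have D0 a : 0 <= D 0 a by rewrite mxE; case: ifPn => // /psi0/ltW.
rewrite mulr_gt0 ?exprn_even_gt0// lt_def sumr_ge0 ?andbT; last first.
  by move=> a _; rewrite mulr_ge0 ?sqr_ge0.
apply/eqP => /eqP; rewrite psumr_eq0; last by move=> a _; rewrite mulr_ge0 ?sqr_ge0.
move=> /allP allD.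
have B0 a : B i a = 0.
  (* The term of weight 0 gives no information on [B i a]; there the entry vanishes because
     centering annihilates the constant first column of [Q]. *)
  have [a0|aN0] := eqVneq (val a) 0%N.
    rewrite !mxE.
    under eq_bigr do rewrite !mxE Q1// mulrBl.
    rewrite sumrB -!mulr_suml (bigD1 i)//= eqxx big1 ?addr0; last first.
      by move=> x /negbTE; rewrite eq_sym => ->.
    by rewrite sumr_const card_ord -[X in X * 1]mulr_natr mulVf// mulr1 subrr.
  have := allD a (mem_index_enum a); rewrite mulf_eq0 sqrf_eq0 mxE (negbTE aN0).
  by rewrite gt_eqF ?psi0//= => /eqP.
(* The diagonal entry of the centering matrix is [1 - n^-1], nonzero for [n >= 2]. *)
have : C i i = 0.
  have -> : C = B *m Q^T by rewrite /B -mulmxA QQ mulmx1.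
  by rewrite mxE big1// => a _; rewrite B0 mul0r.
rewrite !mxE eqxx mulr1n mulr1 => /eqP; rewrite subr_eq0 => /eqP/esym nV.
have : n%:R = 1 :> R by rewrite -[LHS]invrK nV invr1.
by move=> /eqP; rewrite pnatr_eq1 => /eqP n1; rewrite n1 in n2.
Qed.

End steady_covariance.

(** * The conditional mean for a fixed Gaussian law *)

Section conditional_mean.
Context (R : realType) (n : nat) (P : probability (n.-tuple R) R) (S : 'M[R]_n).
Hypothesis gaussP : is_centered_gaussian P S.
Variables (i j : 'I_n) (dbar : R).
Hypotheses (Si : 0 < S i i) (Sj : 0 < S j j) (dbar0 : 0 < dbar).
Local Notation gamma := (normal_prob (0 : R) 1).

Let si := Num.sqrt (S i i).
Let sj := Num.sqrt (S j j).
Let rho := S i j / (si * sj).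
Let a := dbar / si.
Let X (y : n.-tuple R) := tnth y i / si.

Let si0 : 0 < si. Proof. by rewrite sqrtr_gt0. Qed.
Let sj0 : 0 < sj. Proof. by rewrite sqrtr_gt0. Qed.
Let a0 : 0 <= a. Proof. by rewrite ltW// divr_gt0. Qed.
Let SiE : S i i = si ^+ 2. Proof. by rewrite sqr_sqrtr// ltW. Qed.
Let SjE : S j j = sj ^+ 2. Proof. by rewrite sqr_sqrtr// ltW. Qed.
Let SijE : S i j = rho * si * sj.
Proof. by rewrite /rho -mulrA divfK// mulf_neq0// gt_eqF. Qed.

Let mX : measurable_fun setT X.
Proof. by apply: measurable_funM => //; exact: measurable_tnth. Qed.

Let UsetX : [set y : n.-tuple R | Uset dbar (tnth y i)] = X @^-1` Uset a.
Proof.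
apply/seteqP; split => y; rewrite /Uset /X /a /= !in_itv/= !andbT;
  by rewrite -mulNr ltr_pM2r ?ltr_pM2r ?invr_gt0.
Qed.

Let lawX A : measurable A -> P (X @^-1` A) = gamma A.
Proof.
move=> mA; have := gaussian_two_coords gaussP i i si^-1 0 mA; cbv zeta.
rewrite (_ : _ + _ = 1); last by rewrite SiE; field; rewrite gt_eqF.
rewrite oner_eq0 sqrtr1 => <-; congr (P _).
by apply/seteqP; split => y /=; rewrite mul0r addr0 mulrC.
Qed.

(** The variance of [rho * y_i / si - y_j / sj] is [1 - rho ^+ 2]. *)
Let rho_le1 : rho ^+ 2 <= 1.
Proof.
have := cov_form_ge0 gaussP i j (rho / si) (- sj^-1).
rewrite SijE SiE SjE (_ : _ + _ = 1 - rho ^+ 2) ?subr_ge0//.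
by field; rewrite !gt_eqF.
Qed.

Let PU : P [set y | Uset dbar (tnth y i)] = (1 - erf (a / Num.sqrt 2))%:E.
Proof. by rewrite UsetX lawX ?normal_prob_Uset//; exact: measurable_Uset. Qed.

Let mU : measurable [set y : n.-tuple R | Uset dbar (tnth y i)].
Proof. by rewrite UsetX -[_ @^-1` _]setTI; apply: mX => //; exact: measurable_Uset. Qed.

Let num_nondegenerate (s := Num.sqrt (1 - rho ^+ 2)) : 0 < s ->
  (\int[P]_(y in [set y | Uset dbar (tnth y i)]) `|tnth y j|%:E =
   (sj * (Num.sqrt (2 / pi) * (1 - erf (a / Num.sqrt 2 / s) +
      rho * erf (rho * (a / Num.sqrt 2) / s) * expR (- (a / Num.sqrt 2) ^+ 2))))%:E)%E.
Proof.
move=> s0.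
have s2 : s ^+ 2 = 1 - rho ^+ 2 by rewrite sqr_sqrtr// subr_ge0.
pose Z (y : n.-tuple R) := (tnth y j / sj - rho * X y) / s.
have mZ : measurable_fun setT Z.
  apply: measurable_funM => //; apply: measurable_funB.
    by apply: measurable_funM => //; exact: measurable_tnth.
  exact: measurable_funM.
have lawXZ (p q : R) : p ^+ 2 + q ^+ 2 != 0 -> forall A, measurable A ->
    P ((fun y => p * X y + q * Z y) @^-1` A) =
    normal_prob 0 (Num.sqrt (p ^+ 2 + q ^+ 2)) A.
  move=> pq0 A mA.
  (* These are the coefficients of [y_i] and [y_j] in [p X + q Z]. [X] and [Z] are uncorrelated with
     unit variance, so the form has variance [p ^+ 2 + q ^+ 2]. *)
  have := gaussian_two_coords gaussP i j ((p - q * rho / s) / si) (q / (s * sj)) mA.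
  cbv zeta; rewrite (_ : _ + _ = p ^+ 2 + q ^+ 2); last first.
    rewrite SijE SiE SjE.
    transitivity (p ^+ 2 + q ^+ 2 * ((1 - rho ^+ 2) / s ^+ 2)).
      by field; rewrite !gt_eqF.
    by rewrite -s2 divff ?mulr1// expf_neq0// gt_eqF.
  rewrite (negbTE pq0) => <-; congr (P _); apply/funext => y /=; congr A.
  by rewrite /Z /X; field; rewrite !gt_eqF.
rewrite UsetX EFinM.
have rs : rho ^+ 2 + s ^+ 2 = 1 by rewrite s2 addrC subrK.
rewrite -(gaussian_pair_Uset_expectation mX mZ lawXZ a0 s0 rs).
rewrite -ge0_integralZl//; last 3 first.
- by rewrite -UsetX.
- apply/measurable_EFinP/measurable_funTS; apply: measurableT_comp => //.
  by apply: measurable_funD; exact: measurable_funM.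
- by rewrite lee_fin ltW.
apply: eq_integral => y _; rewrite -EFinM -{1}(gtr0_norm sj0) -normrM.
by congr (`| _ |%:E); rewrite /Z; field; rewrite !gt_eqF.
Qed.

Let num_degenerate : rho ^+ 2 = 1 ->
  (\int[P]_(y in [set y | Uset dbar (tnth y i)]) `|tnth y j|%:E =
   (sj * (Num.sqrt (2 / pi) * expR (- (a / Num.sqrt 2) ^+ 2)))%:E)%E.
Proof.
move=> rho2.
have ae_eq : {ae P, forall y, tnth y j = sj * (rho * X y)}.
  (* The variance of [L] is [sj ^+ 2 * (1 - rho ^+ 2) = 0], so its law is the Dirac mass at 0 and
     [L != 0] is a null event. *)
  pose L (y : n.-tuple R) := - (sj * rho / si) * tnth y i + 1 * tnth y j.
  have mL : measurable_fun setT L.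
    by apply: measurable_funD; apply: measurable_funM => //; exact: measurable_tnth.
  have mN : measurable [set~ (0 : R)] by apply: measurableC; exact: measurable_set1.
  exists [set y | [set~ 0] (L y)]; split.
  - by rewrite -[X in measurable X]setTI; exact: mL.
  - have := gaussian_two_coords gaussP i j (- (sj * rho / si)) 1 mN; cbv zeta.
    rewrite (_ : _ + _ = 0); last first.
      rewrite SijE SiE SjE; transitivity (sj ^+ 2 * (1 - rho ^+ 2)).
        by field; rewrite gt_eqF.
      by rewrite rho2 subrr mulr0.
    rewrite eqxx diracE memNset//; exact.
  - move=> y /= yN L0; apply: yN; move: L0; rewrite /L mul1r mulNr => /eqP.
    rewrite addrC subr_eq0 => /eqP ->; rewrite /X; ring.
have abs_rho : `|rho| = 1.
  by apply/eqP; rewrite -sqr_norm_eq1 ?rho2.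
transitivity (\int[P]_(y in [set y | Uset dbar (tnth y i)]) (sj%:E * `|X y|%:E))%E.
  apply: ae_eq_integral => //.
  - apply/measurable_EFinP/measurable_funTS; apply: measurableT_comp => //.
    exact: measurable_tnth.
  - apply: measurable_funeM; apply/measurable_EFinP/measurable_funTS.
    exact: measurableT_comp.
  - apply: filterS ae_eq => y -> _.
    by rewrite normrM [`|rho * _|]normrM abs_rho mul1r (gtr0_norm sj0).
rewrite ge0_integralZl//; last 2 first.
- by apply/measurable_EFinP/measurable_funTS; exact: measurableT_comp.
- by rewrite lee_fin ltW.
rewrite EFinM; congr (_ * _)%E.
rewrite UsetX integral_mkcond.
transitivity (\int[P]_y ((fun x : R => `|x|%:E) \_ (Uset a)) (X y))%E.
  by apply: eq_integral => y _; rewrite /patch.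
have mabs D : measurable_fun D (fun x : R => `|x|%:E).
  apply/measurable_EFinP; apply: measurable_funTS; apply: continuous_measurable_fun.
  exact: norm_continuous.
rewrite (ge0_integral_law (Q := gamma) mX lawX); last 2 first.
- by apply/(measurable_restrictT _ _).1 => //; exact: measurable_Uset.
- by move=> x; rewrite patchE; case: ifPn.
rewrite -integral_mkcond integral_std_normal//; last exact: measurable_Uset.
under eq_integral do rewrite -EFinM.
rewrite ge0_integral_Uset//; last 3 first.
- move=> x; apply: cvgM; last exact: continuous_phi.
  exact: norm_continuous.
- by move=> x; rewrite mulr_ge0 ?phi_ge0.
- by move=> x; rewrite normrN phiN.
have -> : (\int[lebesgue_measure]_(x in `[a, +oo[) (`|x| * phi x)%:E =
    \int[lebesgue_measure]_(x in `[a, +oo[) ((0 + 1 * x) * phi x)%:E)%E.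
  apply: eq_integral => x; rewrite inE/= in_itv/= andbT => ax.
  by rewrite add0r mul1r ger0_norm// (le_trans a0).
rewrite integral_affine_phi; last by move=> y ay; rewrite add0r mul1r (le_trans a0).
rewrite mul0r mul0r addr0 mul1r -EFinM phi_sqrt; congr (_%:E).
have sqr2 : Num.sqrt 2 ^+ 2 = 2 :> R by rewrite sqr_sqrtr.
rewrite sqrtrM// sqrtrV ?pi_ge0// (expr_div_n a) sqr2.
have sqrt2N0 : Num.sqrt 2 != 0 :> R by rewrite gt_eqF// sqrt2_gt0.
have sqrtpiN0 : Num.sqrt pi != 0 :> R by rewrite gt_eqF// sqrtpi_gt0.
set w := expR _; apply: subr0_eq.
rewrite (_ : _ - _ = w / (Num.sqrt 2 * Num.sqrt pi) * (2 - Num.sqrt 2 ^+ 2)).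
  by rewrite sqr2 subrr mulr0.
by field; rewrite sqrtpiN0 sqrt2N0.
Qed.

Lemma gaussian_cond_abs_mean :
  let rho' := Num.sqrt (1 - rho ^+ 2) in
  let dstar := dbar / (Num.sqrt 2 * si) in
  cond_abs_mean P i j dbar = Num.sqrt (2 / pi) * (sj / (1 - erf dstar)) *
    (1 - erf_ratio dstar rho'
     + rho * erf_ratio (rho * dstar) rho' * expR (- dstar ^+ 2)).
Proof.
move=> rho' dstar; rewrite /cond_abs_mean PU /=.
have dE : a / Num.sqrt 2 = dstar by rewrite /a /dstar; field; rewrite !gt_eqF// sqrt2_gt0.
(* For [rho' = 0] the convention of [erf_ratio] cancels [1] against the sign of [dstar], and
   [rho * Num.sg rho = 1] leaves only the exponential. *)
rewrite dE /erf_ratio; case: ifPn => [/eqP r0|rN0].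
  (* [Num.sqrt] also vanishes at negative arguments; [rho_le1] excludes these. *)
  have rho2 : rho ^+ 2 = 1.
    apply/eqP; rewrite eq_le rho_le1/= -subr_le0 -sqrtr_eq0; exact/eqP.
  have d0 : 0 < dstar by rewrite divr_gt0// mulr_gt0 ?sqrt2_gt0.
  rewrite num_degenerate// dE /= gtr0_sg// sgrM (gtr0_sg d0) mulr1.
  have -> : rho * Num.sg rho = 1.
    rewrite mulrC -normrEsg; apply/eqP; rewrite -sqr_norm_eq1 ?rho2//.
  by ring.
rewrite num_nondegenerate ?dE /=; first by ring.
by rewrite lt_def rN0 sqrtr_ge0.
Qed.

End conditional_mean.

(** The admissible levels form the closed half-line starting at [Num.max 0 (m - c)]. *)
Lemma inf_tolerance (R : realType) (m c : R) :
  inf [set d : R | 0 <= d /\ m <= d + c] = if m <= c then 0 else m - c.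
Proof.
have -> : [set d : R | 0 <= d /\ m <= d + c] = `[Num.max 0 (m - c), +oo[%classic.
  apply/seteqP; split => d /=; rewrite in_itv/= andbT ge_max lerBlDr.
    by move=> [-> ->].
  by move=> /andP[].
rewrite inf_itv// /Num.max subr_gt0 ltNge.
by case: (m <= c).
Qed.

Theorem theorem1 (R : realType) (n : nat) (i j : 'I_n) (c deltai : R)
    (b0 tau0 : R) (k0 Q0 : 'M[R]_n) (lam0 : 'I_n -> R) (em ep : R) :
  (2 <= n)%N -> i != j -> 0 < c -> 0 < deltai ->
  nominal_params b0 tau0 k0 Q0 lam0 ->
  0 <= em -> em < 1 -> 0 <= ep ->
  let dbar := deltai + c in
  let S0 := steady_cov b0 tau0 Q0 lam0 in
  let M := ambiguity_set S0 em ep in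
  let E := fun P => cond_abs_mean P i j dbar in
  let supE := sup [set E P | P in M] in
  (forall P, M P ->
    forall S, is_centered_gaussian P S ->
    let sigi := Num.sqrt (S i i) in
    let sigj := Num.sqrt (S j j) in
    let rho := S i j / (sigi * sigj) in
    let rho' := Num.sqrt (1 - rho ^+ 2) in
    let dstar := dbar / (Num.sqrt 2 * sigi) in
    E P = Num.sqrt (2 / pi) * (sigj / (1 - erf dstar)) *
          (1 - erf_ratio dstar rho'
           + rho * erf_ratio (rho * dstar) rho' * expR (- dstar ^+ 2)))
  /\
  inf [set d : R | 0 <= d /\ supE <= d + c] =
    (if supE <= c then 0 else supE - c).
Proof.
move=> n2 ij c0 delta0 nominal em0 em1 ep0 dbar S0 M E supE.
split; last exact: inf_tolerance.
move=> P [S' [gaussS' lower _]] S gaussS.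
have dbar0 : 0 < dbar by rewrite addr_gt0.
have S_gt0 l : 0 < S l l.
  apply: (variance_gt0 gaussS gaussS').
  (* Testing the lower Loewner bound on a unit vector gives [(1 - em) * S0 l l <= S' l l]. *)
  have quadE (A : 'M[R]_n) : quad A (two_coords l l 1 0) = A l l.
    by rewrite (quad_two_coords _ _ (erefl (A l l))); ring.
  have := lower (two_coords l l 1 0); rewrite !quadE mxE.
  apply: lt_le_trans; rewrite mulr_gt0 ?subr_gt0//.
  exact: steady_cov_gt0 n2 nominal.
exact: gaussian_cond_abs_mean.
Qed.
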